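(* There exists a universal constant $C>0$ such that for every weighted finite graph $G$ (as in the context) with $N$ vertices and every natural number $1\leq k\leq N$, \[ \frac{2-\lambda_{N-k+1}}{2}\;\leq\; 1-\overline{h}(k)\;\leq\; Ck^3\sqrt{2-\lambda_{N-k+1}}, \] or equivalently \[ \frac{1}{C^2k^6}\bigl(1-\overline{h}(k)\bigr)^2\;\leq\; 2-\lambda_{N-k+1}\;\leq\; 2\bigl(1-\overline{h}(k)\bigr). \]
   Context: $G=(V,E,w)$ is a finite undirected graph without self-loops, with $N=|V|$ vertices; each edge $\{u,v\}\in E$ carries a positive symmetric weight $w_{uv}=w_{vu}$, and $w_{uv}=0$ if $\{u,v\}\notin E$. The degree is $d_u=\sum_{v}w_{uv}$ (implicitly positive for every vertex), and $\mu(u)=d_u$. For $A,B\subseteq V$, $|E(A,B)|:=\sum_{u\in A,v\in B}w_{uv}$ and $\mathrm{vol}(A):=\sum_{u\in A}d_u$. The normalized Laplacian is $\Delta f(u)=\frac{1}{d_u}\sum_{v}w_{uv}(f(u)-f(v))$ for $f:V\to\mathbb{R}$; it is self-adjoint for $(f,g)_\mu=\sum_u\mu(u)f(u)g(u)$, and its eigenvalues, listed with multiplicity, are $0=\lambda_1\leq\lambda_2\leq\cdots\leq\lambda_N\leq 2$. For disjoint $V_1,V_2\subseteq V$ with $V_1\cup V_2\neq\emptyset$, $\overline{\phi}(V_1,V_2):=\frac{2|E(V_1,V_2)|}{\mathrm{vol}(V_1\cup V_2)}$. A $k$-sub-bipartition is a collection of $k$ pairs $(V_1,V_2),\ldots,(V_{2k-1},V_{2k})$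 of subsets of $V$ with $V_p\cap V_q=\emptyset$ for all $1\leq p\neq q\leq 2k$ and $V_{2i-1}\cup V_{2i}\neq\emptyset$ for each $i$ (individual sets may be empty). The $k$-way dual Cheeger constant is $\overline{h}(k):=\max\min_{1\leq i\leq k}\overline{\phi}(V_{2i-1},V_{2i})$, the maximum over all $k$-sub-bipartitions. *)

(* Defs.v *)
From Stdlib Require Rdefinitions.
From HB Require Import structures.
From mathcomp Require Import all_boot all_order all_algebra.
From mathcomp Require Import Rstruct.
Set Implicit Arguments. Unset Strict Implicit. Unset Printing Implicit Defensive.
Import Order.TTheory GRing.Theory Num.Theory.
Notation RR := Rdefinitions.R.
Local Open Scope ring_scope.

(* A weighted graph on the vertex set 'I_N is given by its weight matrix w:
   w u v > 0 iff {u,v} is an edge, w u v = 0 otherwise. *)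
Definition weighted_graph (N : nat) (w : 'M[RR]_N) : Prop :=
  (forall u v, w u v = w v u) /\ (forall u v, 0 <= w u v) /\
  (forall u, w u u = 0).

Definition deg (N : nat) (w : 'M[RR]_N) (u : 'I_N) : RR := \sum_(v < N) w u v.

Definition Ecut (N : nat) (w : 'M[RR]_N) (A B : {set 'I_N}) : RR :=
  \sum_(u in A) \sum_(v in B) w u v.

Definition vol (N : nat) (w : 'M[RR]_N) (A : {set 'I_N}) : RR :=
  \sum_(u in A) deg w u.

Definition phibar (N : nat) (w : 'M[RR]_N) (A B : {set 'I_N}) : RR :=
  2 * Ecut w A B / vol w (A :|: B).

(* Matrix of the normalized Laplacian: Delta f(u) = f(u) - (1/d_u) sum_v w_uv f(v). *)
Definition normLap (N : nat) (w : 'M[RR]_N) : 'M[RR]_N :=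
  \matrix_(u, v) ((u == v)%:R - w u v / deg w u).

Definition sub_bipartition (N k : nat)
  (P : {ffun 'I_k -> {set 'I_N} * {set 'I_N}}) : bool :=
  [forall i, [disjoint (P i).1 & (P i).2] && ((P i).1 :|: (P i).2 != set0)] &&
  [forall i, forall j, (i != j) ==>
     [&& [disjoint (P i).1 & (P j).1], [disjoint (P i).1 & (P j).2],
         [disjoint (P i).2 & (P j).1] & [disjoint (P i).2 & (P j).2]]].

(* k-way dual Cheeger constant: max over k-sub-bipartitions of the min over i
   of phibar.  The defaults (0 for the max, 1 for the min) are harmless:
   phibar takes values in [0,1], and for 1 <= k <= N the family of
   k-sub-bipartitions and the index set 'I_k are nonempty. *)
Definition hbar (N : nat) (w : 'M[RR]_N) (k : nat) : RR :=
  \big[Num.max/0]_(P : {ffun 'I_k -> {set 'I_N} * {set 'I_N}} | sub_bipartition P)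
     \big[Num.min/1]_(i < k) phibar w (P i).1 (P i).2.

(* Main.v *)
(* First inequality.  The signed indicators of the [k] pairs have disjoint
   supports, so some combination of them is orthogonal to the top [k - 1]
   eigenvectors; its signless energy is controlled term by term by the pairs.

   Second inequality.  The top [k] eigenvectors give a map [F] from the vertices to
   [R^k] whose signless energy [\sum w u v * |F u + F v| ^+ 2] is at most
   [2 * k * (2 - lambda)].  Vertices are compared by the distance of the lines
   spanned by [F u] and [F v].  As [F] is isotropic, a ball of radius
   [1 / (2 * sqrt k)] carries a mass barely above 1 out of a total of [k].
   Deterministic ball growing, in which doubling of [R^k] replaces the usual
   random partition, yields clusters at mutual distance of order [k^(-5/2)]
   that keep all but [1/6] of the mass; they are merged into [k] sets of mass at
   least [1/2].  Cutting [F] off around each of them multiplies the energy by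
   [O(k^5)], and Trevisan's dual Cheeger inequality, applied to one coordinate
   of each localized map, produces the [k] pairs. *)
Require Import Defs.
From Stdlib Require Rdefinitions.
From HB Require Import structures.
From mathcomp Require Import all_boot all_order all_algebra.
From mathcomp Require Import Rstruct.
From mathcomp Require Import ring lra zify.
Import Order.TTheory GRing.Theory Num.Theory.
Set Implicit Arguments. Unset Strict Implicit. Unset Printing Implicit Defensive.
Local Open Scope ring_scope.

(** * Lines in Euclidean space *)

(** Lagrange's identity: the defect is half the sum of the squares of all minors
    [a i * b j - a j * b i]. *)
Lemma cauchy_schwarz (R : realFieldType) (I : finType) (a b : I -> R) :
  (\sum_i a i * b i) ^+ 2 <= (\sum_i a i ^+ 2) * (\sum_i b i ^+ 2).
Proof.
have : 0 <= \sum_i \sum_j (a i * b j - a j * b i) ^+ 2.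
  by apply: sumr_ge0 => i _; apply: sumr_ge0 => j _; apply: sqr_ge0.
have -> : \sum_i \sum_j (a i * b j - a j * b i) ^+ 2 =
    2 * ((\sum_i a i ^+ 2) * (\sum_i b i ^+ 2)) - 2 * (\sum_i a i * b i) ^+ 2.
  have -> : 2 * ((\sum_i a i ^+ 2) * (\sum_i b i ^+ 2)) =
      (\sum_i a i ^+ 2) * (\sum_i b i ^+ 2) + (\sum_i b i ^+ 2) * (\sum_i a i ^+ 2).
    by ring.
  rewrite expr2 3!mulr_suml mulr_sumr -big_split -sumrB /=.
  apply: eq_bigr => i _; rewrite !mulr_sumr -big_split -sumrB /=.
  by apply: eq_bigr => j _; ring.
by lra.
Qed.

Section Euclidean.
Variables (R : rcfType) (k : nat).
Implicit Types x y z : 'rV[R]_k.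

Definition sqnorm x : R := \sum_i x 0 i ^+ 2.
Definition dotp x y : R := \sum_i x 0 i * y 0 i.
Definition enorm x : R := Num.sqrt (sqnorm x).

Lemma sqnorm_ge0 x : 0 <= sqnorm x.
Proof. by apply: sumr_ge0 => i _; apply: sqr_ge0. Qed.

Lemma enorm_ge0 x : 0 <= enorm x. Proof. exact: sqrtr_ge0. Qed.

Lemma sqr_enorm x : enorm x ^+ 2 = sqnorm x.
Proof. by rewrite sqr_sqrtr // sqnorm_ge0. Qed.

Lemma sqnormD x y : sqnorm (x + y) = sqnorm x + 2 * dotp x y + sqnorm y.
Proof.
rewrite /sqnorm /dotp mulr_sumr -!big_split /=.
by apply: eq_bigr => i _; rewrite mxE; ring.
Qed.

Lemma sqnormZ a x : sqnorm (a *: x) = a ^+ 2 * sqnorm x.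
Proof. by rewrite /sqnorm mulr_sumr; apply: eq_bigr => i _; rewrite mxE exprMn. Qed.

Lemma dotpZr a x y : dotp x (a *: y) = a * dotp x y.
Proof. by rewrite /dotp mulr_sumr; apply: eq_bigr => i _; rewrite mxE mulrCA. Qed.

Lemma enormZ a x : enorm (a *: x) = `|a| * enorm x.
Proof. by rewrite /enorm sqnormZ sqrtrM ?sqr_ge0 // sqrtr_sqr. Qed.

Lemma enormN x : enorm (- x) = enorm x.
Proof. by rewrite -scaleN1r enormZ normrN1 mul1r. Qed.

Lemma enormB x y : enorm (x - y) = enorm (y - x).
Proof. by rewrite -enormN opprB. Qed.

Lemma sqnorm_eq0 x : (sqnorm x == 0) = (x == 0).
Proof.
apply/eqP/eqP => [h|->]; last by rewrite /sqnorm big1 // => i _; rewrite mxE expr0n.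
apply/rowP => i; rewrite mxE; apply/eqP; rewrite -sqrf_eq0; apply/eqP.
by apply: (psumr_eq0P _ h) => // j _; apply: sqr_ge0.
Qed.

Lemma enorm_eq0 x : (enorm x == 0) = (x == 0).
Proof. by rewrite -sqnorm_eq0 -sqr_enorm sqrf_eq0. Qed.

Lemma enorm_triangle x y : enorm (x + y) <= enorm x + enorm y.
Proof.
rewrite -(ler_pXn2r (n := 2)) ?nnegrE ?addr_ge0 ?enorm_ge0 //.
rewrite sqrrD !sqr_enorm sqnormD.
suff : dotp x y <= enorm x * enorm y by lra.
apply: le_trans (ler_norm _) _.
rewrite -(ler_pXn2r (n := 2)) ?nnegrE ?normr_ge0 ?mulr_ge0 ?enorm_ge0 //.
by rewrite real_normK ?num_real // exprMn !sqr_enorm cauchy_schwarz.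
Qed.

Definition unitv x : 'rV[R]_k := (enorm x)^-1 *: x.

Lemma unitvE x : x = enorm x *: unitv x.
Proof.
have [->|x0] := eqVneq x 0; first by rewrite /unitv !scaler0.
by rewrite /unitv scalerA divff ?scale1r // enorm_eq0.
Qed.

Lemma sqnorm_unitv x : x != 0 -> sqnorm (unitv x) = 1.
Proof.
by move=> x0; rewrite sqnormZ exprVn sqr_enorm mulVf // sqnorm_eq0.
Qed.

(* At [x = 0] the junk value [unitv 0 = 0] is harmless: it lies at distance 1
   from all unit vectors. *)
Lemma sqnorm_unitv_le1 x : sqnorm (unitv x) <= 1.
Proof.
have [->|x0] := eqVneq x 0; last by rewrite sqnorm_unitv.
by rewrite /unitv scaler0 /sqnorm big1 ?ler01 // => i _; rewrite mxE expr0n.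
Qed.

Lemma enorm_unitv_le1 x : enorm (unitv x) <= 1.
Proof. by rewrite -(sqrtr1 R) ler_wsqrtr // sqnorm_unitv_le1. Qed.

(** On unit vectors this compares lines rather than points, as [x] and [- x] are identified. The
    signless energy is small when [F u] is close to [- F v], so a change of sign has to cost
    nothing. *)
Definition pdist x y : R := Num.min (enorm (x - y)) (enorm (x + y)).

Lemma pdist_ge0 x y : 0 <= pdist x y.
Proof. by rewrite le_min !enorm_ge0. Qed.

Lemma pdistxx x : pdist x x = 0.
Proof.
apply/eqP; rewrite eq_le pdist_ge0 andbT ge_min subrr.
have /eqP -> : enorm (0 : 'rV[R]_k) == 0 by rewrite enorm_eq0.
by rewrite lexx.
Qed.

Lemma pdistC x y : pdist x y = pdist y x.
Proof. by rewrite /pdist (enormB x y) (addrC x y). Qed.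

Lemma pdist_signP x y : exists s : R, [/\ s ^+ 2 = 1 & pdist x y = enorm (x - s *: y)].
Proof.
rewrite /pdist; case: leP => _.
  by exists 1; rewrite expr1n scale1r.
by exists (-1); rewrite sqrrN expr1n scaleN1r opprK.
Qed.

Lemma pdist_le_sign s x y : s ^+ 2 = 1 -> pdist x y <= enorm (x - s *: y).
Proof.
move=> /eqP; rewrite sqrf_eq1 ge_min => /orP[]/eqP ->.
  by rewrite scale1r lexx.
by rewrite scaleN1r opprK lexx orbT.
Qed.

Lemma pdist_triangle x y z : pdist x z <= pdist x y + pdist y z.
Proof.
have [s [s1 ->]] := pdist_signP x y; have [t [t1 ->]] := pdist_signP y z.
have -> : enorm (y - t *: z) = enorm (s *: y - (s * t) *: z).
  have s1' : `|s| = 1.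
    apply/eqP; rewrite -(@sqrp_eq1 _ `|s|) ?normr_ge0 //.
    by rewrite real_normK ?num_real // s1.
  by rewrite -scalerA -scalerBr enormZ s1' mul1r.
apply: le_trans (enorm_triangle _ _).
by rewrite addrA subrK; apply: pdist_le_sign; rewrite exprMn s1 t1 mulr1.
Qed.

(** A Lipschitz bound for the radial projection, up to sign. Scaling [unitv x + unitv y] by
    [enorm y] gives [(x + y) + (enorm y - enorm x) *: unitv x], and both summands have norm at most
    [enorm (x + y)]. *)
Lemma pdist_unitv_mul x y : pdist (unitv x) (unitv y) * enorm y <= 2 * enorm (x + y).
Proof.
have tr := enorm_triangle (x + y) (- x); rewrite enormN addrAC subrr add0r in tr.
have tr' := enorm_triangle (x + y) (- y); rewrite enormN addrK in tr'.
have [->|x0] := eqVneq x 0.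
  have d1 : pdist (unitv 0) (unitv y) <= 1.
    rewrite (le_trans _ (enorm_unitv_le1 y)) //.
    by rewrite ge_min /unitv scaler0 sub0r enormN lexx.
  rewrite add0r; apply: (@le_trans _ _ (1 * enorm y)).
    by rewrite ler_wpM2r // enorm_ge0.
  by rewrite ler_wpM2r ?enorm_ge0 //; lra.
apply: (@le_trans _ _ (enorm (unitv x + unitv y) * enorm y)).
  by rewrite ler_wpM2r ?enorm_ge0 // ge_min lexx orbT.
have -> : enorm (unitv x + unitv y) * enorm y = enorm (enorm y *: unitv x + y).
  by rewrite mulrC -{1}(ger0_norm (enorm_ge0 y)) -enormZ scalerDr -unitvE.
have -> : enorm y *: unitv x + y = (x + y) + (enorm y - enorm x) *: unitv x.
  by rewrite scalerBl -unitvE [RHS]addrC addrA subrK.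
apply: le_trans (enorm_triangle _ _) _.
have -> : 2 * enorm (x + y) = enorm (x + y) + enorm (x + y) by ring.
rewrite lerD2l enormZ.
apply: (@le_trans _ _ (`|enorm y - enorm x| * 1)).
  by rewrite ler_wpM2l // enorm_unitv_le1.
rewrite mulr1 ler_norml; apply/andP; split; [by lra|].
by lra.
Qed.

(** Unit vectors at distance at most [r] up to sign have an inner product of absolute value at least
    [1 - r ^+ 2 / 2], whose square is at least [1 - r ^+ 2]. *)
Lemma near_unitv_dotp (x y : 'rV[R]_k) (r : R) : 0 <= r -> r < 1 ->
  pdist (unitv x) (unitv y) <= r ->
  (1 - r ^+ 2) * sqnorm y <= dotp (unitv x) y ^+ 2.
Proof.
move=> r0 r1 dxy.
have [y0|y0] := eqVneq y 0.
  by rewrite y0 (_ : sqnorm 0 = 0) ?mulr0 ?sqr_ge0 //; apply/eqP; rewrite sqnorm_eq0.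
have [s [s1 ds]] := pdist_signP (unitv x) (unitv y); rewrite ds in dxy.
have : sqnorm (unitv x - s *: unitv y) <= r ^+ 2.
  by rewrite -sqr_enorm ler_pXn2r // ?nnegrE ?enorm_ge0.
rewrite sqnormD -scaleNr (sqnormZ (- s)) sqrrN s1 mul1r (sqnorm_unitv y0) dotpZr.
(* For [x = 0] the vector [unitv x] is 0, at distance 1 from the unit vector [unitv y], which
   contradicts [r < 1]. *)
have [x0|x0] := eqVneq x 0.
  have r21 : r ^+ 2 < 1 by rewrite expr_lt1.
  have u0 : unitv (0 : 'rV[R]_k) = 0 by rewrite /unitv scaler0.
  rewrite x0 u0 (_ : sqnorm 0 = 0); last by apply/eqP; rewrite sqnorm_eq0.
  rewrite (_ : dotp 0 _ = 0); first by lra.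
  by rewrite /dotp big1 // => i _; rewrite mxE mul0r.
rewrite (sqnorm_unitv x0) => h.
have {2}-> := unitvE y.
rewrite dotpZr exprMn sqr_enorm [leLHS]mulrC ler_wpM2l ?sqnorm_ge0 //.
set p := dotp _ _ in h *.
have q2 : (s * p) ^+ 2 = p ^+ 2 by rewrite exprMn s1 mul1r.
rewrite -q2; set q := s * p in h *.
have : 1 - r ^+ 2 / 2 <= q by rewrite /q; lra.
have r2 : r ^+ 2 <= 1 by rewrite expr_le1 // ltW.
move: (r ^+ 2) (sqr_ge0 r) r2 => t t0 t1 hq; nra.
Qed.

End Euclidean.

(** * Ball growing in doubling spaces *)

(** Otherwise each of the [J] steps would multiply by more than [1 + delta], and [a J] would exceed
    [K * a 0]. *)
Lemma slow_step (R : realFieldType) (a : nat -> R) (K delta : R) (J : nat) :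
    (0 < J)%N -> 0 <= delta -> 0 <= a 0%N -> K <= (1 + delta) ^+ J ->
    a J <= K * a 0%N ->
  exists2 j, (j < J)%N & a j.+1 <= (1 + delta) * a j.
Proof.
move=> J0 d0 a0 KJ aJ.
case: (pickP (fun j : 'I_J => a j.+1 <= (1 + delta) * a j)) => [j aj|h].
  by exists (val j); [exact: ltn_ord|exact: aj].
have {}h j : (j < J)%N -> (1 + delta) * a j < a j.+1.
  by move=> jJ; have := h (Ordinal jJ); rewrite /= real_leNgt ?num_real // => /negbFE.
have grow j : (j < J)%N -> (1 + delta) ^+ j.+1 * a 0%N < a j.+1.
  elim: j => [|j IH] jJ; first by rewrite expr1; apply: h.
  apply: le_lt_trans (h _ jJ); rewrite exprS -mulrA ler_wpM2l //; first by lra.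
  by rewrite ltW // IH // ltnW.
have := grow J.-1; rewrite prednK // leqnn => /(_ isT).
rewrite ltNge => /negP[]; apply: le_trans aJ _.
by rewrite ler_wpM2r.
Qed.

Section Clustering.
Variables (R : realFieldType) (T : finType) (m : T -> R) (d : T -> T -> R).
Hypothesis m_ge0 : forall u, 0 <= m u.
Hypothesis dxx : forall u, d u u = 0.
Hypothesis dC : forall u v, d u v = d v u.
Hypothesis d_triangle : forall u v x, d u x <= d u v + d v x.
Implicit Types A B S X : {set T}.

Definition mass A : R := \sum_(u in A) m u.
Definition cball (x : T) (r : R) : {set T} := [set u | d x u <= r].
Definition separated (e : R) (A B : {set T}) : bool :=
  [forall u in A, forall v in B, e < d u v].

Lemma separatedP e A B :
  reflect {in A & B, forall u v, e < d u v} (separated e A B).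
Proof.
apply: (iffP forall_inP) => [h u v uA vB|h u uA].
  by have /forall_inP/(_ v vB) := h u uA.
by apply/forall_inP => v vB; apply: h.
Qed.

Lemma separatedC e A B : separated e A B = separated e B A.
Proof. by apply/separatedP/separatedP => h u v uA vB; rewrite dC h. Qed.

Lemma separatedUr e A B X :
  separated e X (A :|: B) = separated e X A && separated e X B.
Proof.
apply/separatedP/andP => [h|[/separatedP hA /separatedP hB] u v uX].
  by split; apply/separatedP => u v uX v_; apply: h => //; rewrite inE v_ ?orbT.
by rewrite inE => /orP[]; [apply: hA|apply: hB].
Qed.

Lemma separated_disjoint e A B : 0 <= e -> separated e A B -> [disjoint A & B].
Proof.
move=> e0 /separatedP h; rewrite disjoint_subset; apply/subsetP => u uA.
by apply/negP => uB; have := h u u uA uB; rewrite dxx ltNge e0.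
Qed.

Lemma mass_ge0 A : 0 <= mass A.
Proof. by apply: sumr_ge0 => u _; apply: m_ge0. Qed.

Lemma massID A B : mass A = mass (A :&: B) + mass (A :\: B).
Proof. by rewrite /mass (big_setID B). Qed.

(* Region growing: a ball whose center maximizes the mass of [cball y r] is
   enlarged in steps of width [e] until a step gains little; by doubling this
   happens within [J] steps, and the last shell is thrown away. *)
Lemma ball_growing (r e delta K : R) (J : nat) :
    (0 < J)%N -> 0 <= r -> 0 <= e -> 0 <= delta -> 0 <= K ->
    K <= (1 + delta) ^+ J ->
    (forall A x, x \in A -> exists2 y, y \in A &
       mass (A :&: cball x (r + J%:R * e)) <= K * mass (A :&: cball y r)) ->
  forall A, exists s : seq {set T},
    [/\ {in s, forall S, S \subset A /\ exists x, S \subset cball x (r + J%:R * e)},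
        pairwise (separated e) s
      & mass A <= (1 + delta) * \sum_(S <- s) mass S].
Proof.
move=> J0 r0 e0 d0 K0 KJ doubling A.
have [n] := ubnP #|A|; elim: n A => // n IH A.
have [->|[x0 x0A]] := set_0Vmem A.
  move=> _; exists [::]; split=> //.
  by rewrite big_nil mulr0 /mass big_set0.
rewrite ltnS => cA.
have [x xA xmax] := @arg_maxP _ _ _ x0 (mem A) (fun y => mass (A :&: cball y r)) x0A.
pose a j := mass (A :&: cball x (r + j%:R * e)).
have [j jJ aj] : exists2 j, (j < J)%N & a j.+1 <= (1 + delta) * a j.
  apply: (@slow_step _ a K delta J) => //; first exact: mass_ge0.
  have [y yA le_y] := doubling _ _ xA; apply: le_trans le_y _.
  by rewrite ler_wpM2l // /a mul0r addr0; apply: xmax.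
pose S := A :&: cball x (r + j%:R * e).
pose B := cball x (r + j.+1%:R * e).
have [] := IH (A :\: B).
  apply: leq_trans cA; apply: proper_card; rewrite properE subsetDl /=.
  apply/subsetPn; exists x => //; rewrite !inE dxx.
  by rewrite addr_ge0 ?mulr_ge0 ?ler0n.
move=> s [sub_s sep_s mass_s]; exists (S :: s); split.
- move=> X; rewrite inE => /orP[/eqP ->|/sub_s [sXA xX]]; last first.
    by split=> //; apply: subset_trans sXA (subsetDl _ _).
  split; first exact: subsetIl.
  exists x; apply: subset_trans (subsetIr _ _) _.
  apply/subsetP => u; rewrite !inE => /le_trans -> //.
  by rewrite lerD2l ler_wpM2r // ler_nat ltnW.
- rewrite /= sep_s andbT; apply/allP => X /sub_s [sXA _].
  apply/separatedP => u v; rewrite !inE => /andP[_ uS] /(subsetP sXA).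
  rewrite !inE -ltNge => /andP[vB _].
  have := d_triangle x u v; rewrite -natr1 mulrDl mul1r in vB.
  by lra.
rewrite big_cons mulrDr (massID A B); apply: lerD => //.
Qed.

(** Greedy merging along the list: only the head may be lighter than [h]. A light new cluster
    meeting a light head is united with it, and the union stays below [2 * h <= b]. The last clause
    carries separation from outside sets through the merge, as the induction needs. *)
Lemma merge_clusters (e h b : R) (s : seq {set T}) :
    0 <= e -> 2 * h <= b -> pairwise (separated e) s ->
    {in s, forall S, mass S <= b} ->
  exists s' : seq {set T},
    [/\ pairwise (separated e) s', {in s', forall S, mass S <= b},
        {in behead s', forall S, h <= mass S},
        \sum_(S <- s) mass S <= \sum_(S <- s') mass S
      & forall X, all (separated e X) s -> all (separated e X) s'].
Proof.
move=> e0 hb; elim: s => [|S s IH] /=; first by exists [::].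
move=> /andP[Ss sep_s] mass_s.
have [s' [sep' mass' big' tot' all']] :=
  IH sep_s (fun X Xs => mass_s X (mem_behead (s := S :: s) Xs)).
have bS : mass S <= b by apply: mass_s; rewrite mem_head.
case: s' => [|H t] in sep' mass' big' tot' all' *.
  exists [:: S]; split=> //.
  - by move=> X; rewrite inE => /eqP ->.
  - by rewrite !big_cons lerD2l.
  - by move=> X /= /andP[-> _].
have HHt : H \in H :: t by rewrite mem_head.
have /= /andP[SH St] := all' _ Ss.
have /= /andP[Ht sep_t] := sep'.
case: (lerP h (mass S)) => hS.
  exists [:: H, S & t]; split=> //=.
  - by rewrite separatedC SH Ht St sep_t.
  - move=> X; rewrite !inE => /or3P[/eqP->|/eqP->|Xt] //; first exact: mass'.
    by apply: mass'; rewrite inE Xt orbT.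
  - by move=> X; rewrite inE => /orP[/eqP->|/big'].
  - by move: tot'; rewrite !big_cons; lra.
  - by move=> X /andP[-> /all' /= /andP[-> ->]].
case: (lerP h (mass H)) => hH.
  exists [:: S, H & t]; split=> //=.
  - by rewrite SH St Ht sep_t.
  - by move=> X; rewrite in_cons => /orP[/eqP->|/mass'].
  - by move=> X; rewrite inE => /orP[/eqP->|/big'].
  - by move: tot'; rewrite !big_cons; lra.
  - by move=> X /andP[-> /all' /= ->].
have mU : mass (S :|: H) = mass S + mass H.
  rewrite /mass -bigU ?(separated_disjoint e0) //=.
  by apply: eq_bigl => u; rewrite !inE.
exists (S :|: H :: t); split=> //=.
- rewrite sep_t andbT; apply/allP => X Xt.
  by rewrite separatedC separatedUr !(separatedC _ X) (allP St) ?(allP Ht).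
- move=> X; rewrite inE => /orP[/eqP->|Xt]; first by rewrite mU; lra.
  by apply: mass'; rewrite inE Xt orbT.
- by move: tot'; rewrite !big_cons mU; lra.
- by move=> X /andP[XS /all' /= /andP[XH ->]]; rewrite separatedUr XS XH.
Qed.

End Clustering.

Lemma bin_le_exp2 n k : ('C(n, k) <= 2 ^ n)%N.
Proof.
rewrite -{1}(card_ord n) -card_draws; apply: leq_trans (max_card _) _.
by rewrite -cardsT -powersetT card_powerset cardsT card_ord.
Qed.

(* The ball of radius [rho] is covered by at most [2 ^ (4 * k)] cells of diameter
   at most [rho / 2], namely the lattice cubes of side [rho / (2 * sqrt k)], where
   a cube meeting the ball is encoded by the signs and the truncated absolute
   values of its coordinates, the latter summing to at most [2 * k]. *)
Lemma pdist_doubling (R : archiRcfType) (T : finType) (m : T -> R) (k : nat)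
    (x : T -> 'rV[R]_k) (rho : R) (A : {set T}) (c : T) :
    (forall u, 0 <= m u) -> (0 < k)%N -> 0 < rho -> c \in A ->
    let d u v := pdist (x u) (x v) in
  exists2 y, y \in A &
    mass m (A :&: cball d c rho) <= 2 ^+ (4 * k) * mass m (A :&: cball d y (rho / 2)).
Proof.
move=> m0 k0 rho0 cA d.
have [y yA ymax] := @arg_maxP _ _ _ c (mem A)
  (fun y => mass m (A :&: cball d y (rho / 2))) cA.
exists y => //.
(* [sg v] picks between [x v] and [- x v] the one nearer to [x c], so [z v] is a true displacement
   of norm [pdist (x c) (x v)], and a grid can be laid in the linear space. *)
pose sg v : R := if pdist (x c) (x v) == enorm (x c - x v) then 1 else -1.
have sg2 v : sg v ^+ 2 = 1 by rewrite /sg; case: ifP; rewrite ?sqrrN expr1n.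
have sgE v : pdist (x c) (x v) = enorm (x c - sg v *: x v).
  rewrite /sg /pdist; case: leP => [_|h]; first by rewrite eqxx scale1r.
  by rewrite (lt_eqF h) scaleN1r opprK.
pose z v := x c - sg v *: x v.
pose al : R := 2 * Num.sqrt k%:R / rho.
have al2 : al ^+ 2 = 4 * k%:R / rho ^+ 2.
  by rewrite /al expr_div_n exprMn sqr_sqrtr ?ler0n //; ring.
pose tr v i := Num.truncn `|al * z v 0 i|.
pose key v : {ffun 'I_k -> bool} * k.-tuple 'I_(2 * k).+1 :=
  ([ffun i => 0 <= z v 0 i], [tuple inord (tr v i) | i < k]).
pose keys := [set q : {ffun 'I_k -> bool} * k.-tuple 'I_(2 * k).+1 |
  (\sum_(i <- q.2) i <= 2 * k)%N].
have tr_sum v : v \in cball d c rho -> (\sum_(i < k) tr v i <= 2 * k)%N.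
  rewrite inE /d sgE => dv.
  rewrite -(ler_nat R) natr_sum.
  (* Summing [t <= 1 + t ^+ 2 / 4] over the coordinates bounds the total by
     [k + al ^+ 2 * rho ^+ 2 / 4 = 2 * k]. *)
  apply: (@le_trans _ _ (\sum_(i < k) (1 + al ^+ 2 * z v 0 i ^+ 2 / 4))).
    apply: ler_sum => i _; apply: (@le_trans _ _ `|al * z v 0 i|).
      by rewrite Num.Theory.truncn_le normr_ge0.
    rewrite -exprMn -[X in _ <= 1 + X / 4]real_normK ?num_real //.
    have := sqr_ge0 (`|al * z v 0 i| - 2); nra.
  rewrite big_split /= sumr_const card_ord -!mulr_suml -mulr_sumr -/(sqnorm (z v)).
  rewrite -sqr_enorm natrM.
  have : enorm (z v) ^+ 2 <= rho ^+ 2.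
    by rewrite ler_pXn2r ?nnegrE ?enorm_ge0 // ltW.
  rewrite al2 => hz.
  have : 4 * k%:R / rho ^+ 2 * enorm (z v) ^+ 2 <= 4 * k%:R.
    rewrite mulrAC ler_pdivrMr ?exprn_gt0 // ler_wpM2l // mulr_ge0 // ler0n.
  rewrite -mulr_natr mul1r; lra.
have tr_le v i : v \in cball d c rho -> (tr v i < (2 * k).+1)%N.
  by move=> /tr_sum h; rewrite ltnS; apply: leq_trans h; rewrite (bigD1 i) //= leq_addr.
have key_in v : v \in cball d c rho -> key v \in keys.
  move=> vB; rewrite inE big_tuple; apply: leq_trans (tr_sum v vB).
  by apply/eq_leq; apply: eq_bigr => i _; rewrite [(key v).2]/= tnth_mktuple inordK // tr_le.
rewrite {1}/mass (partition_big key (mem keys)) /=; last first.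
  by move=> v; rewrite inE => /andP[_ /key_in].
have cell q : \sum_(v in A :&: cball d c rho | key v == q) m v <=
    mass m (A :&: cball d y (rho / 2)).
  case: (pickP (fun v => (v \in A :&: cball d c rho) && (key v == q))); last first.
    move=> h; rewrite big_pred0; last exact: h.
    by apply: sumr_ge0.
  move=> v /andP[]; rewrite inE => /andP[vA vB] /eqP kv.
  apply: le_trans (ymax v vA).
  rewrite /mass [leRHS](bigID (fun u => (u \in cball d c rho) && (key u == q))) /=.
  rewrite -[leLHS]addr0; apply: lerD; last by apply: sumr_ge0.
  rewrite le_eqVlt; apply/orP; left; apply/eqP; apply: eq_bigl => u.
  rewrite !inE -/(d c u); case uA: (u \in A) => //=.
  case uB: (d c u <= rho) => //=; last by rewrite andbF.
  case ku: (key u == q); last by rewrite andbF.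
  rewrite andbT; symmetry; move/eqP: ku => ku.
  have {}uB : u \in cball d c rho by rewrite inE.
  (* Equal signs and equal truncations put the two scaled coordinates within 1 of each other; over
     [k] coordinates this gives a distance of at most [sqrt k / al = rho / 2]. *)
  have same i : `|al * z v 0 i - al * z u 0 i| <= 1.
    have kuv : key v = key u by rewrite kv ku.
    have := congr1 (fun q : {ffun 'I_k -> bool} * k.-tuple 'I_(2 * k).+1 => q.1 i) kuv.
    rewrite !ffunE => sgn_eq.
    have := congr1 (fun q : {ffun 'I_k -> bool} * k.-tuple 'I_(2 * k).+1 => val (tnth q.2 i)) kuv.
    rewrite !tnth_mktuple /= !inordK ?tr_le //.
    have al0 : 0 <= al by rewrite /al divr_ge0 ?mulr_ge0 ?sqrtr_ge0 ?ltW.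
    rewrite /tr => tr_eq.
    have := Num.Theory.truncn_itv (normr_ge0 (al * z v 0 i)).
    have := Num.Theory.truncn_itv (normr_ge0 (al * z u 0 i)).
    rewrite tr_eq -natr1; set n := Num.truncn _; move: (n%:R) => N.
    rewrite !(normrM al) (ger0_norm al0).
    move: sgn_eq; case: (ger0P (z v 0 i)); case: (ger0P (z u 0 i)) => // _ _ _.
      by rewrite ler_norml; lra.
    by rewrite ler_norml; lra.
  have hz : enorm (z v - z u) <= rho / 2.
    have al20 : 0 < al ^+ 2.
      by rewrite al2 divr_gt0 ?exprn_gt0 // mulr_gt0 // ltr0n.
    rewrite -(ler_pXn2r (n := 2)) ?nnegrE ?enorm_ge0 ?divr_ge0 ?(ltW rho0) //.
    rewrite -(ler_pM2l al20) sqr_enorm /sqnorm mulr_sumr.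
    apply: (@le_trans _ _ (\sum_(i < k) 1)).
      apply: ler_sum => i _; rewrite -exprMn.
      rewrite [(z v - z u) 0 i]mxE [(- z u) 0 i]mxE mulrBr.
      by rewrite -[_ ^+ 2]real_normK ?num_real // expr_le1.
    rewrite sumr_const card_ord al2.
    by rewrite le_eqVlt; apply/orP; left; apply/eqP; field; rewrite gt_eqF.
  rewrite /d (le_trans (pdist_le_sign (s := sg v * sg u) _ _ _)) //.
    by rewrite exprMn !sg2 mulr1.
  have -> : enorm (x v - (sg v * sg u) *: x u) = enorm (z u - z v).
    have s1 : `|sg v| = 1 by rewrite /sg; case: ifP; rewrite ?normrN1 ?normr1.
    rewrite -[LHS]mul1r -s1 -enormZ scalerBr scalerA mulrA -expr2 sg2 mul1r.
    by rewrite /z opprB [X in _ = enorm X]addrC addrA subrK.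
  by rewrite enormB.
apply: (@le_trans _ _ (\sum_(q in keys) mass m (A :&: cball d y (rho / 2)))).
  by apply: ler_sum => q _; apply: cell.
rewrite sumr_const -[leLHS]mulr_natl ler_wpM2r ?mass_ge0 // -natrX ler_nat.
(* There are [2 ^ k] sign patterns and ['C(3 * k, k) <= 2 ^ (3 * k)] tuples of sum at most [2 * k],
   whence the exponent [4 * k]. *)
have -> : keys = setX [set: {ffun 'I_k -> bool}]
    [set t : k.-tuple 'I_(2 * k).+1 | \sum_(i <- t) i <= 2 * k]%N.
  by apply/setP => -[b t]; rewrite !inE.
rewrite cardsX cardsT card_ffun card_bool card_ord card_partial_ord_partitions.
apply: leq_trans (leq_mul (leqnn _) (bin_le_exp2 _ _)) _.
by rewrite -expnD leq_exp2l //; lia.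
Qed.
(** * The dual Cheeger inequality *)

(** Averaging: if no index worked, all [a i - beta * b i] would be nonnegative with sum at most 0,
    hence all zero, which forces every [b i] to vanish. Indices with [b i = 0] are tolerated
    provided [a i] is not negative there. *)
Lemma exists_ratio_le (R : realFieldType) (I : eqType) (r : seq I) (a b : I -> R)
    (beta : R) :
    {in r, forall i, 0 <= b i} -> {in r, forall i, b i = 0 -> 0 <= a i} ->
    \sum_(i <- r) a i <= beta * \sum_(i <- r) b i -> 0 < \sum_(i <- r) b i ->
  exists2 i, i \in r & 0 < b i /\ a i <= beta * b i.
Proof.
move=> b0 ab le_ab sb0.
case: (boolP (has (fun i => (0 < b i) && (a i <= beta * b i)) r)).
  by move=> /hasP[i ir /andP[]]; exists i.
move=> /hasPn none; suff b_eq0 : {in r, forall i, b i = 0}.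
  by move: sb0; rewrite big_seq big1 ?ltxx.
have ge0 i : i \in r -> 0 <= a i - beta * b i.
  move=> ir; have := none i ir; rewrite lt_neqAle b0 // andbT negb_and negbK.
  rewrite -ltNge => /orP[/eqP bi|/ltW]; last by lra.
  by rewrite -bi mulr0 subr0; apply: ab.
have : \sum_(i <- r | i \in r) (a i - beta * b i) == 0.
  rewrite eq_le [X in _ && X]sumr_ge0 ?andbT //.
  by rewrite -big_seq sumrB -mulr_sumr subr_le0.
rewrite psumr_eq0 // => /allP z i ir; have := none i ir.
have /implyP/(_ ir)/eqP zi := z i ir.
rewrite lt_neqAle b0 // andbT negb_and negbK => /orP[/eqP ->//|].
by rewrite -ltNge; lra.
Qed.

(* Discrete form of [x ^+ 2 = \int_0^x 2 t dt]. *)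
Lemma layer_cake (R : realFieldType) (s : seq R) :
    {in s, forall x : R, 0 <= x} ->
  exists L : seq (R * R),
    {in L, forall c, 0 <= c.1 /\ 0 < c.2} /\
    {in s, forall x : R, x ^+ 2 = \sum_(c <- L) c.1 * (c.2 <= x)%R%:R}.
Proof.
move=> s0; suff : exists L : seq (R * R), {in L, forall c, 0 <= c.1 /\ 0 < c.2} /\
    {in sort >=%R s, forall x : R, x ^+ 2 = \sum_(c <- L) c.1 * (c.2 <= x)%R%:R}.
  by move=> [L [L0 LE]]; exists L; split=> // x xs; apply: LE; rewrite mem_sort.
have : {in sort >=%R s, forall x : R, 0 <= x} by move=> x; rewrite mem_sort; apply: s0.
have : sorted >=%R (sort >=%R s) by apply: sort_sorted => x y; apply: le_total.
elim: (sort _ s) => [|x r IH] /=; first by move=> _ _; exists [::].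
(* The induction needs more: the thresholds do not exceed the largest value [x], and the weights sum
   to [x ^+ 2]. A larger new head then only adds one layer, whose weight is the difference of the
   squares. *)
suff main : sorted >=%R (x :: r) -> {in x :: r, forall y : R, 0 <= y} ->
  exists L : seq (R * R), [/\ {in L, forall c, 0 <= c.1 /\ 0 < c.2 <= x},
    {in x :: r, forall y : R, y ^+ 2 = \sum_(c <- L) c.1 * (c.2 <= y)%R%:R}
    & \sum_(c <- L) c.1 = x ^+ 2].
  move=> h1 h2; have [L [L0 LE _]] := main h1 h2; exists L; split=> // c /L0.
  by move=> [-> /andP[]].
elim: r x {IH} => [|y r IH] x /= srt pos.
  have x0 : 0 <= x by apply: pos; rewrite mem_head.
  have [->|xn0] := eqVneq x 0.
    exists [::]; split=> //; last by rewrite big_nil expr0n.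
    by move=> z; rewrite inE => /eqP ->; rewrite big_nil expr0n.
  exists [:: (x ^+ 2, x)]; split.
  - by move=> c; rewrite inE => /eqP -> /=; rewrite sqr_ge0 lexx lt_def xn0 x0.
  - by move=> z; rewrite inE => /eqP ->; rewrite big_seq1 lexx mulr1.
  - by rewrite big_seq1.
have /andP[yx srt'] := srt.
have [L [L0 LE Ltot]] := IH y srt' (fun z h => pos z (mem_behead (s := x :: y :: r) h)).
have [xy|xy] := eqVneq x y.
  rewrite xy; exists L; split=> // z; rewrite inE => /orP[/eqP ->|]; last exact: LE.
  by apply: LE; rewrite mem_head.
have {xy}yx' : y < x by rewrite lt_def xy.
have x0 : 0 <= x by apply: pos; rewrite mem_head.
have y0 : 0 <= y by apply: pos; rewrite !inE eqxx orbT.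
exists ((x ^+ 2 - y ^+ 2, x) :: L); split.
- move=> c; rewrite inE => /orP[/eqP ->|/L0 [-> /andP[-> cy]]] /=.
    by rewrite lexx subr_ge0 ler_pXn2r ?nnegrE // yx (le_lt_trans y0).
  by rewrite (le_trans cy yx).
- move=> z; rewrite inE => /orP[/eqP ->|zr]; rewrite big_cons /=.
    rewrite lexx mulr1 (_ : \sum_(c <- L) _ = y ^+ 2); first by rewrite subrK.
    rewrite -Ltot; apply: eq_big_seq => c /L0 [_ /andP[_ cy]].
    by rewrite (le_trans cy yx) mulr1.
  have zy : z <= y.
    have := order_path_min (x := y) (s := r) (leT := >=%R) => h.
    move: zr; rewrite inE => /orP[/eqP -> //|].
    by move/allP: (h (fun a b c p q => le_trans q p) srt'); apply.
  by rewrite (lt_geF (le_lt_trans zy yx')) mulr0 add0r; apply: LE.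
- by rewrite big_cons Ltot subrK.
Qed.

Section DualCheeger.
Variables (N : nat) (w : 'M[RR]_N).
Hypothesis w_graph : weighted_graph w.

(** The sum runs over ordered pairs, so this is twice the quadratic form of [2 - Delta] for the
    inner product weighted by degrees. *)
Definition signless_energy (f : 'I_N -> RR) : RR :=
  \sum_u \sum_v w u v * (f u + f v) ^+ 2.

Definition sqnorm_deg (f : 'I_N -> RR) : RR := \sum_u deg w u * f u ^+ 2.

Lemma wC u v : w u v = w v u. Proof. by case: w_graph. Qed.
Lemma w_ge0 u v : 0 <= w u v. Proof. by case: w_graph => _ []. Qed.

Lemma deg_ge0 u : 0 <= deg w u.
Proof. by apply: sumr_ge0 => v _; apply: w_ge0. Qed.

Lemma signless_energy_ge0 f : 0 <= signless_energy f.
Proof.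
by apply: sumr_ge0 => u _; apply: sumr_ge0 => v _; rewrite mulr_ge0 ?w_ge0 ?sqr_ge0.
Qed.

Lemma sqnorm_deg_ge0 f : 0 <= sqnorm_deg f.
Proof. by apply: sumr_ge0 => u _; rewrite mulr_ge0 ?deg_ge0 ?sqr_ge0. Qed.

Lemma sum_deg_mul (g : 'I_N -> RR) :
  \sum_u deg w u * g u = 2^-1 * \sum_u \sum_v w u v * (g u + g v).
Proof.
have e1 : \sum_u deg w u * g u = \sum_u \sum_v w u v * g u.
  by apply: eq_bigr => u _; rewrite /deg mulr_suml.
have e2 : \sum_u deg w u * g u = \sum_u \sum_v w u v * g v.
  rewrite e1 exchange_big /=; apply: eq_bigr => u _.
  by apply: eq_bigr => v _; rewrite wC.
have -> : \sum_u \sum_v w u v * (g u + g v) =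
    \sum_u \sum_v w u v * g u + \sum_u \sum_v w u v * g v.
  rewrite -big_split; apply: eq_bigr => u _; rewrite -big_split.
  by apply: eq_bigr => v _; rewrite /= mulrDr.
by rewrite -e1 -e2; lra.
Qed.

Lemma Ecut_sym (A B : {set 'I_N}) :
  2 * Ecut w A B =
  \sum_u \sum_v w u v * (((u \in A) && (v \in B))%R%:R + ((v \in A) && (u \in B))%R%:R).
Proof.
have e1 : Ecut w A B = \sum_u \sum_v w u v * ((u \in A) && (v \in B))%R%:R.
  rewrite /Ecut big_mkcond /=; apply: eq_bigr => u _.
  case: (u \in A) => /=; last by rewrite big1 // => v _; rewrite mulr0.
  rewrite big_mkcond /=; apply: eq_bigr => v _.
  by case: (v \in B); rewrite ?mulr1 ?mulr0.
have e2 : Ecut w A B = \sum_u \sum_v w u v * ((v \in A) && (u \in B))%R%:R.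
  rewrite e1 exchange_big /=; apply: eq_bigr => u _.
  by apply: eq_bigr => v _; rewrite wC.
have -> : 2 * Ecut w A B = Ecut w A B + Ecut w A B by ring.
rewrite {1}e1 e2 -big_split; apply: eq_bigr => u _ /=; rewrite -big_split.
by apply: eq_bigr => v _; rewrite /= mulrDr.
Qed.

Lemma volE (A : {set 'I_N}) : vol w A = \sum_u deg w u * (u \in A)%R%:R.
Proof.
rewrite /vol big_mkcond; apply: eq_bigr => u _.
by case: (u \in A); rewrite ?mulr1 ?mulr0.
Qed.

(** The edge-wise estimate behind Trevisan's argument; by symmetry [|y| <= |x|]. For equal signs the
    left side is at most [x ^+ 2 + y ^+ 2]. For opposite signs every threshold up to [|y|] cuts the
    edge and contributes nothing positive, which leaves
    [x ^+ 2 - y ^+ 2 = |x + y| * (|x| + |y|)]. *)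
Lemma signless_coarea (x y : RR) (L : seq (RR * RR)) :
    {in L, forall c, 0 <= c.1 /\ 0 < c.2} ->
    `|x| ^+ 2 = \sum_(c <- L) c.1 * (c.2 <= `|x|)%R%:R ->
    `|y| ^+ 2 = \sum_(c <- L) c.1 * (c.2 <= `|y|)%R%:R ->
  \sum_(c <- L) c.1 * ((c.2 <= `|x|)%R%:R + (c.2 <= `|y|)%R%:R -
     2 * (((c.2 <= x) && (y <= - c.2))%R%:R + ((c.2 <= y) && (x <= - c.2))%R%:R)) <=
  `|x + y| * (`|x| + `|y|).
Proof.
have half (x' y' : RR) : {in L, forall c, 0 <= c.1 /\ 0 < c.2} ->
    `|x'| ^+ 2 = \sum_(c <- L) c.1 * (c.2 <= `|x'|)%R%:R ->
    `|y'| ^+ 2 = \sum_(c <- L) c.1 * (c.2 <= `|y'|)%R%:R -> `|y'| <= `|x'| ->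
  \sum_(c <- L) c.1 * ((c.2 <= `|x'|)%R%:R + (c.2 <= `|y'|)%R%:R -
     2 * (((c.2 <= x') && (y' <= - c.2))%R%:R + ((c.2 <= y') && (x' <= - c.2))%R%:R)) <=
  `|x' + y'| * (`|x'| + `|y'|).
  move=> L0 Lx Ly yx.
  have [xy|xy] := lerP 0 (x' * y').
    apply: (@le_trans _ _ (`|x'| ^+ 2 + `|y'| ^+ 2)).
      rewrite Lx Ly -big_split big_seq [leRHS]big_seq; apply: ler_sum => c /L0 [c0 _] /=.
      rewrite -mulrDr ler_wpM2l // lerBlDr lerDl mulr_ge0 // addr_ge0 //; exact: ler0n.
    have XY : `|x'| * `|y'| = x' * y' by rewrite -normrM ger0_norm.
    have -> : `|x' + y'| = `|x'| + `|y'|.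
      apply/eqP; rewrite -(eqrXn2 (n := 2)) ?addr_ge0 // real_normK ?num_real //.
      by rewrite !sqrrD !real_normK ?num_real // XY.
    by have := mulr_ge0 (normr_ge0 x') (normr_ge0 y'); lra.
  apply: (@le_trans _ _ (`|x'| ^+ 2 - `|y'| ^+ 2)).
    rewrite Lx Ly -sumrB big_seq [leRHS]big_seq; apply: ler_sum => c /L0 [c0 c0'] /=.
    rewrite -mulrBr ler_wpM2l //.
    have [cy|cy] := lerP c.2 `|y'|; last first.
      rewrite addr0 subr0 lerBlDr lerDl mulr_ge0 // addr_ge0 //; exact: ler0n.
    rewrite (le_trans cy yx).
    suff : 1 <= ((c.2 <= x') && (y' <= - c.2))%R%:R + ((c.2 <= y') && (x' <= - c.2))%R%:R :> RR.
      by rewrite subrr; move: (_ + _ : RR) => t; rewrite mulr1n; lra.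
    have cx := le_trans cy yx.
    move: xy cx cy; case: (ger0P x') => x0; case: (ger0P y') => y0 xy cx cy.
    - by nra.
    - have -> : c.2 <= x' by [].
      have -> : y' <= - c.2 by lra.
      by rewrite /= lerDl; exact: ler0n.
    - have -> : c.2 <= y' by [].
      have -> : x' <= - c.2 by lra.
      by rewrite /= lerDr; exact: ler0n.
    - by nra.
  have XY : `|x'| * `|y'| = - (x' * y') by rewrite -normrM ltr0_norm.
  have -> : `|x' + y'| = `|x'| - `|y'|.
    apply/eqP; rewrite -(eqrXn2 (n := 2)) ?subr_ge0 // real_normK ?num_real //.
    by rewrite sqrrB sqrrD !real_normK ?num_real // XY mulNrn opprK.
  by rewrite -subr_sqr.
move=> L0 Lx Ly; case: (lerP `|y| `|x|) => [/half|/ltW/half]; first exact.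
rewrite (addrC x) (addrC `|x|) => /(_ L0 Ly Lx); apply: le_trans.
rewrite le_eqVlt; apply/orP; left; apply/eqP; apply: eq_bigr => c _.
by congr (_ * (_ - 2 * _)); rewrite addrC.
Qed.

(** Cauchy-Schwarz over ordered pairs with weights [w u v], followed by
    [(a + b) ^+ 2 <= 2 * (a ^+ 2 + b ^+ 2)]; the factor [2^-1] makes the constants cancel
    exactly. *)
Lemma signless_cauchy_schwarz (f : 'I_N -> RR) :
  2^-1 * \sum_u \sum_v w u v * (`|f u + f v| * (`|f u| + `|f v|)) <=
  Num.sqrt (signless_energy f * sqnorm_deg f).
Proof.
set S := \sum_u _.
have S0 : 0 <= S.
  apply: sumr_ge0 => u _; apply: sumr_ge0 => v _.
  by rewrite mulr_ge0 ?w_ge0 // mulr_ge0 // addr_ge0.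
rewrite -(ler_pXn2r (n := 2)) ?nnegrE ?sqrtr_ge0 ?mulr_ge0 ?invr_ge0 //.
rewrite sqr_sqrtr ?mulr_ge0 ?signless_energy_ge0 ?sqnorm_deg_ge0 //.
have CS := cauchy_schwarz
  (fun p : 'I_N * 'I_N => Num.sqrt (w p.1 p.2) * `|f p.1 + f p.2|)
  (fun p => Num.sqrt (w p.1 p.2) * (`|f p.1| + `|f p.2|)).
have sw u v : Num.sqrt (w u v) ^+ 2 = w u v by rewrite sqr_sqrtr ?w_ge0.
have e1 : S = \sum_(p : 'I_N * 'I_N) Num.sqrt (w p.1 p.2) * `|f p.1 + f p.2| *
      (Num.sqrt (w p.1 p.2) * (`|f p.1| + `|f p.2|)).
  rewrite /S pair_bigA; apply: eq_bigr => p _ /=.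
  by rewrite -{1}sw; ring.
rewrite -e1 in CS.
rewrite exprMn; apply: le_trans (ler_wpM2l _ CS) _; first exact: sqr_ge0.
have -> : \sum_(p : 'I_N * 'I_N) (Num.sqrt (w p.1 p.2) * `|f p.1 + f p.2|) ^+ 2 =
    signless_energy f.
  rewrite /signless_energy pair_bigA; apply: eq_bigr => p _ /=.
  by rewrite exprMn sw real_normK ?num_real.
rewrite mulrCA ler_wpM2l ?signless_energy_ge0 //.
rewrite /sqnorm_deg sum_deg_mul pair_bigA !mulr_sumr; apply: ler_sum => p _ /=.
rewrite exprMn sw.
have := sqr_ge0 (`|f p.1| - `|f p.2|).
rewrite -(real_normK (num_real (f p.1))) -(real_normK (num_real (f p.2))).
have := w_ge0 p.1 p.2; nra.
Qed.

Hypothesis deg_gt0 : forall u, 0 < deg w u.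

Lemma vol_gt0 (A : {set 'I_N}) : A != set0 -> 0 < vol w A.
Proof.
move=> /set0Pn[u uA]; rewrite /vol (big_setD1 u) //= ltr_pwDl //.
by apply: sumr_ge0 => v _; apply: deg_ge0.
Qed.

(** Each level [t] gives the pair of sets [f >= t] and [f <= - t]. With the layer-cake weights of
    [|f|], the volumes add up to [sqnorm_deg w f] and the uncut parts to at most [beta] times it, so
    some level does as well as the average. *)
Lemma dual_cheeger (f : 'I_N -> RR) : 0 < sqnorm_deg f ->
  exists A B : {set 'I_N}, [/\ [disjoint A & B], A :|: B != set0,
    A :|: B \subset [set u | f u != 0]
  & 1 - phibar w A B <= Num.sqrt (signless_energy f / sqnorm_deg f)].
Proof.
move=> f0; set beta := Num.sqrt _.
have [L [L0 LE]] := @layer_cake _ [seq `|f u| | u : 'I_N] (fun x =>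
  ltac:(by move=> /imageP[u _ ->]; exact: normr_ge0)).
have {}LE u : `|f u| ^+ 2 = \sum_(c <- L) c.1 * (c.2 <= `|f u|)%R%:R.
  by apply: LE; apply: image_f.
pose P (c : RR * RR) := [set u | c.2 <= f u].
pose Q (c : RR * RR) := [set u | f u <= - c.2].
have PQ c u : 0 < c.2 -> (u \in P c :|: Q c) = (c.2 <= `|f u|).
  by move=> c0; rewrite !inE ler_normr lerNr.
have volPQ c : 0 < c.2 -> vol w (P c :|: Q c) = \sum_u deg w u * (c.2 <= `|f u|)%R%:R.
  by move=> c0; rewrite volE; apply: eq_bigr => u _; rewrite PQ.
have tot : \sum_(c <- L) c.1 * vol w (P c :|: Q c) = sqnorm_deg f.
  rewrite big_seq (eq_bigr (fun c => \sum_u deg w u * (c.1 * (c.2 <= `|f u|)%R%:R))).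
    rewrite -big_seq exchange_big; apply: eq_bigr => u _ /=.
    by rewrite -mulr_sumr -LE real_normK ?num_real.
  move=> c /L0 [_ c0]; rewrite volPQ // mulr_sumr.
  by apply: eq_bigr => u _; rewrite mulrCA.
have [||||c cL [b0 ab]] := @exists_ratio_le _ _ L
    (fun c => c.1 * (vol w (P c :|: Q c) - 2 * Ecut w (P c) (Q c)))
    (fun c => c.1 * vol w (P c :|: Q c)) beta.
- move=> c /L0 [c0 _]; rewrite mulr_ge0 //.
  by apply: sumr_ge0 => u _; apply: deg_ge0.
- move=> c /L0 [c0 _] /eqP; rewrite mulf_eq0 => /orP[/eqP ->|]; first by rewrite mul0r.
  have [e|/vol_gt0/gt_eqF -> //] := eqVneq (P c :|: Q c) set0.
  move=> _; have P0 : P c = set0 by apply/eqP; rewrite -subset0 -e subsetUl.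
  by rewrite e /vol /Ecut P0 !big_set0 mulr0 subr0 mulr0.
- rewrite tot.
  have -> : beta * sqnorm_deg f = Num.sqrt (signless_energy f * sqnorm_deg f).
    rewrite /beta -{2}(ger0_norm (ltW f0)) -sqrtr_sqr -sqrtrM; last first.
      by rewrite divr_ge0 ?signless_energy_ge0 ?sqnorm_deg_ge0.
    by congr Num.sqrt; field; rewrite gt_eqF.
  apply: le_trans (signless_cauchy_schwarz f).
  rewrite big_seq (eq_bigr (fun c => 2^-1 * \sum_u \sum_v w u v *
     (c.1 * ((c.2 <= `|f u|)%R%:R + (c.2 <= `|f v|)%R%:R -
     2 * (((c.2 <= f u) && (f v <= - c.2))%R%:R + ((c.2 <= f v) && (f u <= - c.2))%R%:R))))).
    rewrite -big_seq -mulr_sumr ler_wpM2l ?invr_ge0 //.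
    rewrite exchange_big; apply: ler_sum => u _ /=.
    rewrite exchange_big; apply: ler_sum => v _ /=.
    rewrite -mulr_sumr ler_wpM2l ?w_ge0 //.
    exact: signless_coarea.
  move=> c /L0 [_ c0]; rewrite volPQ // sum_deg_mul Ecut_sym.
  have -> : forall x y : RR, c.1 * (2^-1 * x - y) = 2^-1 * (c.1 * x - c.1 * (2 * y)).
    by move=> x y; field.
  congr (_ * _); rewrite !mulr_sumr -sumrB; apply: eq_bigr => u _.
  rewrite !mulr_sumr -sumrB; apply: eq_bigr => v _; rewrite !inE; ring.
- by rewrite tot.
have [c0 c0'] := L0 c cL.
have c1 : 0 < c.1.
  rewrite lt_def c0 andbT; apply/eqP => z; move: b0; rewrite z mul0r ltxx //.
have vol0 : 0 < vol w (P c :|: Q c) by move: b0; rewrite pmulr_rgt0.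
exists (P c), (Q c); split.
- rewrite disjoint_subset; apply/subsetP => u; rewrite !inE => h.
  by rewrite -ltNge; lra.
- by apply/eqP => e; move: vol0; rewrite e /vol big_set0 ltxx.
- apply/subsetP => u; rewrite PQ // inE => h.
  by rewrite -normr_gt0; apply: lt_le_trans h.
- move: ab; rewrite mulrCA ler_pM2l // => ab.
  rewrite -(ler_pM2r vol0) /phibar mulrBl divfK ?gt_eqF // mul1r //.
Qed.

End DualCheeger.

(** * Orthogonal diagonalization *)

Lemma char_poly_conj (R : comNzRingType) n (P Q A : 'M[R]_n) :
  P *m Q = 1%:M -> char_poly (P *m A *m Q) = char_poly A.
Proof.
move=> PQ; rewrite /char_poly.
have -> : char_poly_mx (P *m A *m Q) =
    map_mx (@polyC R) P *m char_poly_mx A *m map_mx (@polyC R) Q.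
  rewrite /char_poly_mx mulmxBr mulmxBl !map_mxM; congr (_ - _).
  by rewrite mul_mx_scalar -scalemxAl -map_mxM PQ map_mx1 scalemx1.
rewrite !det_mulmx mulrAC -det_mulmx -map_mxM PQ map_mx1 det1 mul1r //.
Qed.

(* A Householder reflection exchanging [u] and the first basis vector. *)
Lemma orthogonal_first_row (R : rcfType) n (u : 'rV[R]_n.+1) :
  sqnorm u = 1 -> exists H : 'M[R]_n.+1, H *m H^T = 1%:M /\ row 0 H = u.
Proof.
move=> u1; pose e : 'rV[R]_n.+1 := delta_mx 0 0.
have [->|ue] := eqVneq u e.
  by exists 1%:M; rewrite trmx1 mulmx1 row1.
pose x := u - e; pose c := 2 / sqnorm x.
have x0 : sqnorm x != 0 by rewrite sqnorm_eq0 subr_eq0.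
have xxT : x *m x^T = (sqnorm x)%:M.
  apply/matrixP => i j; rewrite !ord1 !mxE eqxx mulr1n.
  by apply: eq_bigr => l _; rewrite !mxE expr2.
have xT : (x^T *m x)^T = x^T *m x by rewrite trmx_mul trmxK.
exists (1%:M - c *: (x^T *m x)); split.
  have -> : (1%:M - c *: (x^T *m x))^T = 1%:M - c *: (x^T *m x).
    rewrite -[in RHS]xT -[in RHS](trmx1 R).
    by apply/matrixP => i j; rewrite !mxE.
  clearbody x; rewrite mulmxBr mulmx1 mulmxBl mul1mx.
  have -> : c *: (x^T *m x) *m (c *: (x^T *m x)) = (c * 2) *: (x^T *m x).
    rewrite -scalemxAl -scalemxAr mulmxA -(mulmxA x^T) xxT mul_mx_scalar -!scalemxAl.
    by rewrite !scalerA /c; congr (_ *: _); field.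
  by rewrite mulrDr mulr1 scalerDl opprB addrK subrK.
rewrite rowE mulmxBr mulmx1 -scalemxAr mulmxA.
have -> : delta_mx 0 0 *m x^T = (u 0 0 - 1)%:M :> 'M[R]_1.
  rewrite -rowE; apply/matrixP => i j; rewrite !ord1 !mxE eqxx mulr1n; congr (_ - _).
have sx : sqnorm x = 2 - 2 * u 0 0.
  rewrite sqnormD u1.
  have -> : sqnorm (- e) = 1.
    rewrite /sqnorm (bigD1 0) //= !mxE eqxx sqrrN expr1n big1 ?addr0 // => i i0.
    by rewrite !mxE (negPf i0) oppr0 expr0n.
  have -> : dotp u (- e) = - u 0 0.
    rewrite /dotp (bigD1 0) //= !mxE eqxx mulrN1 big1 ?addr0 // => i i0.
    by rewrite !mxE (negPf i0) oppr0 mulr0.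
  by ring.
rewrite mul_scalar_mx scalerA.
have -> : c * (u 0 0 - 1) = -1.
  rewrite /c; apply: (mulfI x0); rewrite mulrA mulrCA divff // mulr1 sx; ring.
by rewrite scaleN1r opprK /x addrC subrK.
Qed.

(** Deflation: a reflection whose first row is a unit eigenvector for the head [a] of [lam] turns
    [S] into a block matrix with corner [a], whose off-diagonal blocks vanish by symmetry. The lower
    block has the remaining roots, so the eigenvectors come out in the order of [lam]. *)
Lemma symmetric_orthodiag (R : rcfType) n (S : 'M[R]_n) (lam : seq R) :
    S^T = S -> char_poly S = \prod_(x <- lam) ('X - x%:P) ->
  exists Q : 'M[R]_n, Q *m Q^T = 1%:M /\
    forall i, row i Q *m S = lam`_i *: row i Q.
Proof.
elim: n lam S => [|n IH] lam S symS chS.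
  by exists 1%:M; split=> [|[]//]; rewrite trmx1 mulmx1.
have : size lam = n.+1.
  by apply: succn_inj; rewrite -(size_prod_XsubC lam id) -chS size_char_poly.
case: lam chS => // a lam chS _.
have /eigenvalueP[v vS v0] : eigenvalue S a.
  by rewrite eigenvalue_root_char chS root_prod_XsubC mem_head.
have uS : unitv v *m S = a *: unitv v.
  by rewrite /unitv -scalemxAl vS !scalerA mulrC.
have [H [HH Hu]] := orthogonal_first_row (sqnorm_unitv v0).
have HH' : H^T *m H = 1%:M by apply: mulmx1C.
pose S' : 'M_(1 + n) := H *m S *m H^T.
have symS' : S'^T = S' by rewrite /S' !trmx_mul trmxK symS mulmxA.
have row0 : row 0 S' = a *: delta_mx 0 0.
  rewrite /S' 2!row_mul Hu uS -scalemxAl -Hu -row_mul HH row1 //.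
have S'def : S' = H *m S *m H^T by [].
have {}row0 j : S' 0 j = a * (j == 0)%:R.
  by have := congr1 (fun A : 'rV_n.+1 => A 0 j) row0; rewrite [LHS]mxE !mxE.
clearbody S'.
have ul : ulsubmx S' = a%:M.
  apply/matrixP => i j; rewrite !ord1 !mxE eqxx mulr1n.
  have := row0 0; rewrite eqxx mulr1 => <-.
  by congr (S' _ _); apply: val_inj.
have ur : ursubmx S' = 0.
  apply/matrixP => i j; rewrite !ord1 !mxE.
  have := row0 (rshift 1 j); rewrite mulr0 => <-.
  by congr (S' _ _); apply: val_inj.
have dl : dlsubmx S' = 0.
  by rewrite -[S']symS' -trmx_ursub ur trmx0.
have S'E : S' = block_mx a%:M 0 0 (drsubmx S') by rewrite -{1}[S']submxK ul ur dl.
have [||Q [QQ Qe]] := IH lam (drsubmx S').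
- by rewrite trmx_drsub symS'.
- have : char_poly S' = char_poly S by rewrite S'def; apply: char_poly_conj.
  rewrite chS big_cons S'E /char_poly /char_poly_mx.
  rewrite (@scalar_mx_block _ 1 n) map_block_mx opp_block_mx add_block_mx.
  rewrite !map_mx0 !oppr0 !addr0 det_lblock => h.
  apply: (mulfI (negbT (polyXsubC_eq0 a))).
  rewrite -h block_mxKdr; congr (_ * _).
  by rewrite det_mx11 !mxE eqxx.
pose B : 'M_(1 + n) := block_mx 1%:M 0 0 Q.
have BB : B *m B^T = 1%:M.
  rewrite /B tr_block_mx mulmx_block.
  rewrite !trmx0 trmx1 !mulmx0 !mul0mx !mulmx1 !addr0 !add0r QQ.
  by rewrite (@scalar_mx_block _ 1 n).
exists (B *m H); split.
  by rewrite trmx_mul mulmxA -(mulmxA _ H) HH mulmx1.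
suff main : B *m S' =
    \matrix_(i, j) ((a :: lam)`_i * B i j).
  move=> i; rewrite -row_mul.
  have -> : B *m H *m S = \matrix_(i, j) ((a :: lam)`_i * B i j) *m H.
    by rewrite -main S'def -!mulmxA HH' mulmx1.
  rewrite !row_mul.
  rewrite scalemxAl; congr (_ *m _).
  by apply/rowP => j; rewrite !mxE.
rewrite S'E /B mulmx_block !mulmx0 !mul0mx !addr0 !add0r mul1mx.
apply/matrixP => i j; rewrite [RHS]mxE.
case: (splitP i) => i' ii; [have -> : i = lshift n i' by apply: val_inj|
  have -> : i = rshift 1 i' by apply: val_inj];
case: (splitP j) => j' jj; [have -> : j = lshift n j' by apply: val_inj|
  have -> : j = rshift 1 j' by apply: val_inj|
  have -> : j = lshift n j' by apply: val_inj|
  have -> : j = rshift 1 j' by apply: val_inj];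
rewrite ?block_mxEul ?block_mxEur ?block_mxEdl ?block_mxEdr.
- by rewrite !ord1 !mxE eqxx mulr1n mulr1.
- by rewrite !mxE mulr0.
- by rewrite !mxE mulr0.
- have := congr1 (fun A : 'rV_n => A 0 j') (Qe i').
  by rewrite -row_mul !mxE /= => ->.
Qed.

(** * Spectral expansion and test functions *)

Lemma sorted_nth_le (R : realFieldType) (s : seq R) i j :
  sorted <=%R s -> (i <= j < size s)%N -> s`_i <= s`_j.
Proof.
move=> srt /andP[ij js]; apply: (sorted_leq_nth le_trans lexx) => //.
by rewrite inE (leq_ltn_trans ij js).
Qed.

Section Spectral.
Variables (N : nat) (w : 'M[RR]_N).
Hypothesis w_graph : weighted_graph w.
Hypothesis deg_gt0 : forall u, 0 < deg w u.

Definition dot_deg (f g : 'I_N -> RR) : RR := \sum_u deg w u * (f u * g u).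

(** Conjugation by the square roots of the degrees makes the Laplacian symmetric. Dividing its
    orthonormal eigenvectors by these roots gives functions orthonormal for [dot_deg]; the expansion
    in the last clause comes from [Q^T *m Q = 1%:M]. *)
Lemma laplacian_eigenbasis (lam : seq RR) :
    char_poly (normLap w) = \prod_(x <- lam) ('X - x%:P) ->
  exists f : 'I_N -> 'I_N -> RR,
    [/\ forall i j, dot_deg (f i) (f j) = (i == j)%:R,
        forall i u, \sum_v w u v * f i v = (1 - lam`_i) * (deg w u * f i u)
      & forall g u, g u = \sum_i dot_deg g (f i) * f i u].
Proof.
move=> chL; pose s u := Num.sqrt (deg w u).
have s_gt0 u : 0 < s u by rewrite sqrtr_gt0.
have s_neq0 u : s u != 0 by rewrite gt_eqF.
have ss u : s u * s u = deg w u by rewrite -expr2 sqr_sqrtr // ltW.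
pose D := diag_mx (\row_u s u); pose D' := diag_mx (\row_u (s u)^-1).
have DD' : D *m D' = 1%:M.
  rewrite /D /D' mulmx_diag; apply/matrixP => i j; rewrite !mxE.
  by rewrite divff //.
pose S := D *m normLap w *m D'.
have SE u v : S u v = (u == v)%:R - w u v / (s u * s v).
  rewrite /S mul_mx_diag mxE mul_diag_mx !mxE mulrBr mulrBl; congr (_ - _).
    case: eqVneq => [->|_]; last by rewrite mulr0 mul0r.
    by rewrite mulr1 divff.
  by rewrite -ss; field; rewrite !s_neq0.
have symS : S^T = S.
  by apply/matrixP => u v; rewrite mxE !SE eq_sym (wC w_graph) (mulrC (s v)).
have [Q [QQ Qe]] : exists Q : 'M[RR]_N, Q *m Q^T = 1%:M /\
    forall i, row i Q *m S = lam`_i *: row i Q.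
  by apply: symmetric_orthodiag => //; rewrite -chL; apply: char_poly_conj.
have QQ' : Q^T *m Q = 1%:M by apply: mulmx1C.
exists (fun i u => Q i u / s u); split.
- move=> i j; have := congr1 (fun A : 'M_N => A i j) QQ; rewrite !mxE => <-.
  apply: eq_bigr => u _; rewrite mxE -ss.
  by field; rewrite s_neq0.
- move=> i v; have := congr1 (fun A : 'rV_N => A 0 v) (Qe i); rewrite !mxE.
  rewrite (eq_bigr (fun u => Q i u * (u == v)%:R - w v u * (Q i u / s u) / s v)); last first.
    move=> u _; rewrite SE mxE mulrBr (wC w_graph v); congr (_ - _).
    by field; rewrite !s_neq0.
  rewrite sumrB -mulr_suml (bigD1 v) //= eqxx mulr1 big1 ?addr0; last first.
    by move=> u /negPf ->; rewrite mulr0.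
  rewrite -ss; set X := \sum_u _ => h.
  have -> : X = (X / s v) * s v by rewrite divfK.
  have -> : X / s v = (1 - lam`_i) * Q i v by rewrite mulrBl -h; ring.
  by field; rewrite s_neq0.
- move=> g u; rewrite /dot_deg.
  have -> : g u = (\sum_v (s v * g v) * (v == u)%:R) / s u.
    rewrite (bigD1 u) //= eqxx big1 => [|v /negPf ->]; last by rewrite mulr0.
    by rewrite mulr1 addr0 mulrC mulKf.
  have e v : (v == u)%:R = \sum_i Q i v * Q i u :> RR.
    have := congr1 (fun A : 'M_N => A v u) QQ'; rewrite !mxE => <-.
    by apply: eq_bigr => i _; rewrite mxE.
  rewrite (eq_bigr (fun v => \sum_i (s v * g v) * (Q i v * Q i u))); last first.
    by move=> v _; rewrite e mulr_sumr.
  rewrite exchange_big mulr_suml; apply: eq_bigr => i _ /=.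
  rewrite !mulr_suml; apply: eq_bigr => v _; rewrite -ss.
  by field; rewrite !s_neq0.
Qed.

Lemma signless_energyE (g : 'I_N -> RR) :
  signless_energy w g = 2 * (sqnorm_deg w g + \sum_u \sum_v w u v * (g u * g v)).
Proof.
rewrite /sqnorm_deg (sum_deg_mul w_graph) mulrDr mulrA divff ?mul1r ?pnatr_eq0 //.
rewrite mulr_sumr -big_split; apply: eq_bigr => u _ /=.
rewrite mulr_sumr -big_split; apply: eq_bigr => v _ /=; ring.
Qed.

Lemma sqnorm_deg_dot g : sqnorm_deg w g = dot_deg g g.
Proof. by apply: eq_bigr => u _; rewrite expr2. Qed.

Section Eigenbasis.
Variables (lam : seq RR) (f : 'I_N -> 'I_N -> RR).
Hypothesis f_orth : forall i j, dot_deg (f i) (f j) = (i == j)%:R.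
Hypothesis f_eigen :
  forall i u, \sum_v w u v * f i v = (1 - lam`_i) * (deg w u * f i u).
Hypothesis f_span : forall g u, g u = \sum_i dot_deg g (f i) * f i u.

Lemma sqnorm_deg_spectral g : sqnorm_deg w g = \sum_i dot_deg g (f i) ^+ 2.
Proof.
rewrite sqnorm_deg_dot {1}/dot_deg.
rewrite (eq_bigr (fun u => \sum_i dot_deg g (f i) * (deg w u * (g u * f i u)))).
  by rewrite exchange_big; apply: eq_bigr => i _; rewrite -mulr_sumr -expr2.
move=> u _; rewrite [X in _ * (_ * X)]f_span !mulr_sumr.
by apply: eq_bigr => i _; ring.
Qed.

Lemma weight_form_spectral g :
  \sum_u \sum_v w u v * (g u * g v) = \sum_(i < N) (1 - lam`_i) * dot_deg g (f i) ^+ 2.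
Proof.
transitivity (\sum_u \sum_(i < N) g u * dot_deg g (f i) * ((1 - lam`_i) * (deg w u * f i u))).
  apply: eq_bigr => u _.
  rewrite (eq_bigr (fun v => \sum_i g u * dot_deg g (f i) * (w u v * f i v))).
    by rewrite exchange_big; apply: eq_bigr => i _; rewrite -mulr_sumr f_eigen.
  move=> v _; rewrite [g v]f_span !mulr_sumr; apply: eq_bigr => i _; ring.
rewrite exchange_big; apply: eq_bigr => i _ /=.
rewrite expr2 [X in _ = _ * (_ * X)]/dot_deg !mulr_sumr.
by apply: eq_bigr => u _; ring.
Qed.

Lemma signless_energy_spectral g :
  signless_energy w g = 2 * \sum_(i < N) (2 - lam`_i) * dot_deg g (f i) ^+ 2.
Proof.
rewrite signless_energyE sqnorm_deg_spectral weight_form_spectral -big_split /=.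
by congr (_ * _); apply: eq_bigr => i _; ring.
Qed.

Lemma signless_energy_eigen i : signless_energy w (f i) = 2 * (2 - lam`_i).
Proof.
rewrite signless_energy_spectral (bigD1 i) //= f_orth eqxx expr1n mulr1 big1 ?addr0 //.
by move=> j /negPf ji; rewrite f_orth eq_sym ji expr0n mulr0.
Qed.

(** The Dirichlet energy of [f i] is twice its eigenvalue. The bound serves to dominate the default
    value [0] of the maximum in [hbar]. *)
Lemma eigenvalue_ge0 (i : 'I_N) : 0 <= lam`_i.
Proof.
have : 0 <= \sum_u \sum_v w u v * (f i u - f i v) ^+ 2.
  apply: sumr_ge0 => u _; apply: sumr_ge0 => v _.
  by rewrite mulr_ge0 ?sqr_ge0 ?(w_ge0 w_graph).
suff -> : \sum_u \sum_v w u v * (f i u - f i v) ^+ 2 = 2 * lam`_i by lra.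
have -> : \sum_u \sum_v w u v * (f i u - f i v) ^+ 2 =
    2 * (sqnorm_deg w (f i) - \sum_u \sum_v w u v * (f i u * f i v)).
  rewrite /sqnorm_deg (sum_deg_mul w_graph) mulrBr mulrA divff ?mul1r ?pnatr_eq0 //.
  rewrite mulr_sumr -sumrB; apply: eq_bigr => u _ /=.
  rewrite mulr_sumr -sumrB; apply: eq_bigr => v _ /=; ring.
have -> : sqnorm_deg w (f i) = 1 by rewrite sqnorm_deg_dot f_orth eqxx.
rewrite weight_form_spectral (bigD1 i) //= f_orth eqxx expr1n mulr1 big1 ?addr0.
  by ring.
by move=> j /negPf ji; rewrite f_orth eq_sym ji expr0n mulr0.
Qed.

(** Courant-Fischer for the signed indicators [g i]: the spectral lower bound for the energy of a
    suitable combination [h], set against the upper bound by cut weights, controls the mean of the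
    [phibar] values with weights [a 0 i ^+ 2 * vol w (A i :|: B i)], hence one of them. *)
Lemma sub_bipartition_phibar_le (k : nat) (P : {ffun 'I_k -> {set 'I_N} * {set 'I_N}}) :
    size lam = N -> sorted <=%R lam -> (1 <= k <= N)%N -> sub_bipartition P ->
  exists i, phibar w (P i).1 (P i).2 <= lam`_(N - k) / 2.
Proof.
move=> szlam srt /andP[k1 kN] /andP[/forallP P1 /forallP P2].
pose A i := (P i).1; pose B i := (P i).2.
have disjAB i u : u \in A i -> u \in B i -> False.
  by have /andP[/disjointFr h _] := P1 i => uA uB; rewrite (h u uA) in uB.
have disj i j u : u \in A i :|: B i -> u \in A j :|: B j -> i = j.
  move=> ui uj; apply/eqP; case: (boolP (i == j)) => // ij; exfalso.
  have /forallP/(_ j)/implyP/(_ ij)/and4P[h1 h2 h3 h4] := P2 i.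
  move: ui uj; rewrite !inE => /orP[] ui /orP[] uj.
  - by rewrite (disjointFr h1 ui) in uj.
  - by rewrite (disjointFr h2 ui) in uj.
  - by rewrite (disjointFr h3 ui) in uj.
  - by rewrite (disjointFr h4 ui) in uj.
pose g i u : RR := (u \in A i)%:R - (u \in B i)%:R.
have g0 i u : u \notin A i :|: B i -> g i u = 0.
  by rewrite inE negb_or /g => /andP[/negPf -> /negPf ->]; rewrite subrr.
have g2 i u : g i u ^+ 2 = (u \in A i :|: B i)%:R.
  rewrite /g inE; have := disjAB i u.
  case: (u \in A i) => [|_]; case: (u \in B i) => /=.
  - by move=> /(_ isT isT).
  - by rewrite subr0 expr1n.
  - by rewrite sub0r sqrrN expr1n.
  - by rewrite subrr expr0n.
(* Counted from 0, the entry of [lam] at [N - k] is the eigenvalue of the theorem; the [k - 1]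
   indices strictly above it are those to which [h] is made orthogonal. *)
have topP (j : 'I_k.-1) : (N - k + j.+1 < N)%N by have := ltn_ord j; lia.
pose M : 'M[RR]_(k, k.-1) :=
  \matrix_(i, j) dot_deg (g i) (f (Ordinal (topP j))).
(* [M] has only [k - 1] columns, so its [k] rows are linearly dependent. *)
have [a /sub_kermxP aM a0] : exists2 a : 'rV_k, (a <= kermx M)%MS & a != 0.
  apply/rowV0Pn; rewrite -mxrank_eq0 mxrank_ker -lt0n subn_gt0.
  by apply: leq_ltn_trans (rank_leq_col M) _; rewrite prednK.
pose h u : RR := \sum_i a 0 i * g i u.
have hE i u : u \in A i :|: B i -> h u = a 0 i * g i u.
  move=> ui; rewrite /h (bigD1 i) //= big1 ?addr0 // => j ji.
  rewrite g0 ?mulr0 //; apply: contra ji => uj.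
  by apply/eqP; apply: disj uj ui.
have h_out u : (forall i, u \notin A i :|: B i) -> h u = 0.
  by move=> out; rewrite /h big1 // => i _; rewrite g0 ?mulr0.
have h2 u : h u ^+ 2 = \sum_i a 0 i ^+ 2 * (u \in A i :|: B i)%:R.
  case: (pickP (fun i => u \in A i :|: B i)) => [i ui|out].
    rewrite (hE i u ui) exprMn g2 (bigD1 i) //= big1 ?addr0 // => j ji.
    rewrite [_ \in _](_ : _ = false) ?mulr0 //; apply/negP => uj.
    by case/eqP: ji; apply: disj uj ui.
  rewrite h_out => [|i]; last by rewrite out.
  by rewrite expr0n big1 // => i _; rewrite out mulr0.
pose cr i u v : RR :=
  ((u \in A i) && (v \in B i))%:R + ((v \in A i) && (u \in B i))%:R.
have cr0 i u v : u \notin A i :|: B i -> cr i u v = 0.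
  by rewrite /cr inE negb_or => /andP[/negPf -> /negPf ->]; rewrite andbF addr0.
(* If [u] and [v] lie in the same pair, both sides agree: [h v] is [- h u] across the cut and [h u]
   on the same side. In all other cases the cut term vanishes and the plain bound [dflt]
   suffices. *)
have pointwise u v :
    (h u + h v) ^+ 2 <= 2 * (h u ^+ 2 + h v ^+ 2) - 4 * \sum_i a 0 i ^+ 2 * cr i u v.
  have dflt : (h u + h v) ^+ 2 <= 2 * (h u ^+ 2 + h v ^+ 2).
    by have := sqr_ge0 (h u - h v); rewrite sqrrB sqrrD; lra.
  case: (pickP (fun i => u \in A i :|: B i)) => [i ui|out]; last first.
    by rewrite big1 ?mulr0 ?subr0 // => i _; rewrite cr0 ?mulr0 ?out.
  rewrite (bigD1 i) //= big1 ?addr0; last first.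
    move=> j ji; rewrite cr0 ?mulr0 //; apply: contra ji => uj.
    by apply/eqP; apply: disj uj ui.
  case: (boolP (v \in A i :|: B i)) => vi; last first.
    suff -> : cr i u v = 0 by rewrite !mulr0 subr0.
    by move: vi; rewrite /cr inE negb_or => /andP[/negPf -> /negPf ->]; rewrite andbF addr0.
  rewrite (hE i u ui) (hE i v vi) /g /cr; have := disjAB i u; have := disjAB i v.
  move: ui vi (a 0 i) => /[!inE] ui vi x; move: ui vi.
  by case: (u \in A i); case: (u \in B i); case: (v \in A i); case: (v \in B i) => //=
    _ _ dv du; try (by case: (du isT isT)); try (by case: (dv isT isT));
    rewrite ?mulr0n ?mulr1n; nra.
have normE : sqnorm_deg w h = \sum_i a 0 i ^+ 2 * vol w (A i :|: B i).
  rewrite /sqnorm_deg (eq_bigr (fun u => \sum_i a 0 i ^+ 2 * (deg w u * (u \in A i :|: B i)%:R))).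
    by rewrite exchange_big; apply: eq_bigr => i _; rewrite -mulr_sumr -volE.
  by move=> u _; rewrite h2 mulr_sumr; apply: eq_bigr => i _; rewrite mulrCA.
have upper : signless_energy w h <=
    4 * sqnorm_deg w h - 4 * \sum_i a 0 i ^+ 2 * (2 * Ecut w (A i) (B i)).
  have -> : \sum_i a 0 i ^+ 2 * (2 * Ecut w (A i) (B i)) =
      \sum_u \sum_v w u v * \sum_i a 0 i ^+ 2 * cr i u v.
    rewrite (eq_bigr (fun i => \sum_u \sum_v w u v * (a 0 i ^+ 2 * cr i u v))).
      rewrite exchange_big; apply: eq_bigr => u _ /=.
      by rewrite exchange_big; apply: eq_bigr => v _; rewrite mulr_sumr.
    move=> i _; rewrite (Ecut_sym w_graph) mulr_sumr; apply: eq_bigr => u _.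
    by rewrite mulr_sumr; apply: eq_bigr => v _; rewrite mulrCA.
  have -> : 4 * sqnorm_deg w h = \sum_u \sum_v w u v * (2 * (h u ^+ 2 + h v ^+ 2)).
    rewrite /sqnorm_deg (sum_deg_mul w_graph) mulrA mulr_sumr; apply: eq_bigr => u _.
    by rewrite mulr_sumr; apply: eq_bigr => v _; field.
  rewrite mulr_sumr -sumrB; apply: ler_sum => u _.
  rewrite mulr_sumr -sumrB; apply: ler_sum => v _.
  by rewrite [4 * _]mulrCA -mulrBr ler_wpM2l ?(w_ge0 w_graph) // pointwise.
(* Only the indices up to [N - k] contribute, and among these [2 - lambda] is smallest at
   [N - k]. *)
have lower : 2 * ((2 - lam`_(N - k)) * sqnorm_deg w h) <= signless_energy w h.
  rewrite signless_energy_spectral sqnorm_deg_spectral ler_wpM2l // mulr_sumr.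
  apply: ler_sum => j _; have [jk|jk] := leqP j (N - k).
    rewrite ler_wpM2r ?sqr_ge0 // lerD2l lerN2.
    by apply: sorted_nth_le => //; rewrite szlam jk /=; lia.
  have jj : (j - (N - k).+1 < k.-1)%N by have := ltn_ord j; lia.
  have jE : Ordinal (topP (Ordinal jj)) = j by apply: val_inj => /=; lia.
  have := congr1 (fun V : 'rV_k.-1 => V 0 (Ordinal jj)) aM.
  rewrite !mxE (_ : \sum_i _ = dot_deg h (f j)) => [->|]; first by rewrite expr0n !mulr0.
  rewrite /dot_deg (eq_bigr (fun i => \sum_u a 0 i * (deg w u * (g i u * f j u)))).
    rewrite exchange_big; apply: eq_bigr => u _ /=.
    by rewrite /h [_ * f j u]mulr_suml mulr_sumr; apply: eq_bigr => i _; ring.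
  by move=> i _; rewrite mxE jE /dot_deg mulr_sumr.
have vol0 i : 0 < vol w (A i :|: B i).
  by apply: vol_gt0 => //; have /andP[] := P1 i.
have [||||i _ [b0 ab]] := @exists_ratio_le _ _ (index_enum 'I_k)
    (fun i => a 0 i ^+ 2 * (2 * (2 * Ecut w (A i) (B i))))
    (fun i => a 0 i ^+ 2 * vol w (A i :|: B i)) lam`_(N - k).
- by move=> i _; rewrite mulr_ge0 ?sqr_ge0 ?ltW.
- move=> i _ _; rewrite mulr_ge0 ?sqr_ge0 // mulr_ge0 // mulr_ge0 //.
  by apply: sumr_ge0 => u _; apply: sumr_ge0 => v _; apply: w_ge0.
- rewrite -normE (eq_bigr (fun i => 2 * (a 0 i ^+ 2 * (2 * Ecut w (A i) (B i))))).
    by rewrite -mulr_sumr; lra.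
  by move=> i _; rewrite mulrCA.
- have [i ai] : exists i, a 0 i != 0 by apply/rV0Pn.
  rewrite (bigD1 i) //=; apply: ltr_pwDl.
    by rewrite mulr_gt0 // exprn_even_gt0.
  by apply: sumr_ge0 => j _; rewrite mulr_ge0 ?sqr_ge0 ?ltW.
exists i; rewrite /phibar.
have ai : 0 < a 0 i ^+ 2 by rewrite -(pmulr_lgt0 _ (vol0 i)).
move: ab; rewrite [lam`_(N - k) * (_ * _)]mulrCA ler_pM2l // => ab.
by rewrite (ler_pdivrMr _ _ (vol0 i)) mulrAC ler_pdivlMr // mulrC.
Qed.

End Eigenbasis.
End Spectral.
(** * Localization *)

Lemma bernoulli (R : realFieldType) (x : R) n : 0 <= x -> 1 + n%:R * x <= (1 + x) ^+ n.
Proof.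
move=> x0; elim: n => [|n IH]; first by rewrite mul0r addr0.
rewrite exprS; apply: le_trans (ler_wpM2l _ IH); last by lra.
by rewrite -natr1; have := ler0n R n; nra.
Qed.

Section Localization.
Variables (N : nat) (w : 'M[RR]_N) (k : nat) (F : 'I_N -> 'rV[RR]_k).
Hypothesis w_graph : weighted_graph w.
Hypothesis deg_gt0 : forall u, 0 < deg w u.
Hypothesis k_gt0 : (0 < k)%N.

Local Notation d := (fun u v => pdist (unitv (F u)) (unitv (F v))).
Local Notation m := (fun u => deg w u * sqnorm (F u)).

Hypothesis F_isotropic : forall x, \sum_u deg w u * dotp x (F u) ^+ 2 = sqnorm x.
Hypothesis F_total : mass m [set: 'I_N] = k%:R.

(** Isotropy tested on the direction of the centre gives a total of at most 1, and every point of
    the ball has at least the share [1 - r ^+ 2] of its mass in that direction. *)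
Lemma ball_mass_le c (r : RR) (S : {set 'I_N}) : 0 <= r -> r < 1 ->
  S \subset cball d c r -> (1 - r ^+ 2) * mass m S <= 1.
Proof.
move=> r0 r1 Sc; apply: le_trans (sqnorm_unitv_le1 (F c)).
rewrite -F_isotropic /mass mulr_sumr [leRHS](bigID (mem S)) /= -[leLHS]addr0.
apply: lerD; last first.
  by apply: sumr_ge0 => u _; rewrite mulr_ge0 ?sqr_ge0 ?(deg_ge0 w_graph).
apply: ler_sum => u uS; rewrite mulrCA ler_wpM2l ?(deg_ge0 w_graph) //.
apply: near_unitv_dotp => //.
by have := subsetP Sc u uS; rewrite inE.
Qed.

Lemma separated_clusters : exists s : seq {set 'I_N},
  [/\ (k <= size s)%N, {in s, forall S, 1 / 2 <= mass m S}
    & pairwise (separated d (96 * k%:R ^+ 2 * Num.sqrt k%:R)^-1) s].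
Proof.
pose q : RR := Num.sqrt k%:R; pose e : RR := (96 * k%:R ^+ 2 * q)^-1; rewrite -/q -/e.
have k1 : 1 <= k%:R :> RR by rewrite ler1n.
have q2 : q ^+ 2 = k%:R by rewrite sqr_sqrtr // ler0n.
have q0 : 0 < q by rewrite sqrtr_gt0; lra.
have q_neq0 : q != 0 by rewrite gt_eqF.
have k_neq0 : k%:R != 0 :> RR by rewrite gt_eqF //; lra.
have e0 : 0 <= e by rewrite invr_ge0 mulr_ge0 ?(ltW q0) // mulr_ge0 // exprn_ge0 // ler0n.
have m0 u : 0 <= m u by rewrite mulr_ge0 ?sqnorm_ge0 ?(deg_ge0 w_graph).
have dxx u : d u u = 0 by apply: pdistxx.
have dC u v : d u v = d v u by apply: pdistC.
have dT u v x : d u x <= d u v + d v x by apply: pdist_triangle.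
(* The factor [1 + delta] costs at most [delta * k = 1 / 6] of the mass. Since
   [(1 + delta) ^+ (6 * k) >= 2], the doubling constant [2 ^+ (4 * k)] is reached in [24 * k ^ 2]
   steps, and [e] is [rho / 2] divided by this number. *)
pose rho : RR := (2 * q)^-1; pose delta : RR := (6 * k%:R)^-1.
have rho0 : 0 < rho by rewrite invr_gt0 mulr_gt0.
have delta0 : 0 <= delta by rewrite invr_ge0 mulr_ge0 ?ler0n.
have radius : rho / 2 + (24 * k ^ 2)%N%:R * e = rho.
  rewrite /rho /e natrM natrX -/q; field.
  by rewrite q_neq0 k_neq0.
have J0 : (0 < 24 * k ^ 2)%N by rewrite muln_gt0 expn_gt0 k_gt0.
have KJ : 2 ^+ (4 * k) <= (1 + delta) ^+ (24 * k ^ 2).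
  have -> : (24 * k ^ 2 = (6 * k) * (4 * k))%N by lia.
  rewrite [leRHS]exprM; apply: lerXn2r; rewrite ?nnegrE //; first by rewrite exprn_ge0 ?addr_ge0.
  apply: le_trans (bernoulli _ delta0); rewrite natrM /delta divff ?mulf_neq0 //.
  by rewrite pnatr_eq0.
have doubling (A : {set 'I_N}) c : c \in A -> exists2 y, y \in A &
    mass m (A :&: cball d c (rho / 2 + (24 * k ^ 2)%N%:R * e)) <=
    2 ^+ (4 * k) * mass m (A :&: cball d y (rho / 2)).
  by move=> cA; rewrite radius; apply: pdist_doubling.
have K0 : 0 <= 2 ^+ (4 * k) :> RR by rewrite exprn_ge0.
have rho20 : 0 <= rho / 2 by rewrite divr_ge0 ?(ltW rho0).
have [s [sub_s sep_s tot_s]] :=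
  ball_growing m0 dxx dT J0 rho20 e0 delta0 K0 KJ doubling [set: 'I_N].
rewrite F_total in tot_s.
(* Here [rho ^+ 2 = 1 / (4 * k)], and [1 / (1 - 1 / (4 * k))] is at most [1 + 1 / (3 * k)]. *)
have mass_s : {in s, forall S, mass m S <= 1 + (3 * k%:R)^-1}.
  move=> S /sub_s [_ [c]]; rewrite radius => Sc.
  have rho1 : rho < 1.
    rewrite invf_lt1 ?mulr_gt0 //.
    have : 1 <= q by rewrite -(sqrtr1 RR) ler_wsqrtr.
    by lra.
  have := ball_mass_le (ltW rho0) rho1 Sc.
  have -> : rho ^+ 2 = (4 * k%:R)^-1 by rewrite /rho exprVn exprMn q2; congr (_^-1); ring.
  set M := mass _ _.
  have -> : (4 * k%:R)^-1 = k%:R^-1 / 4 :> RR by field.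
  have -> : (3 * k%:R)^-1 = k%:R^-1 / 3 :> RR by field.
  have t0 : 0 < k%:R^-1 :> RR by rewrite invr_gt0; lra.
  have t1 : k%:R^-1 <= 1 :> RR by rewrite invf_le1 //; lra.
  move: (k%:R^-1 : RR) t0 t1 => t t0 t1; nra.
have [|s' [sep' mass' big' tot' _]] :=
    @merge_clusters _ _ m d dxx dC e (1 / 2) (1 + (3 * k%:R)^-1) s e0 _ sep_s mass_s.
  have : 0 <= (3 * k%:R)^-1 :> RR by rewrite invr_ge0; lra.
  by lra.
have tot : k%:R - 1 / 6 <= \sum_(S <- s') mass m S.
  apply: le_trans tot'; move: tot_s; set X := \sum_(S <- s) _.
  rewrite leNgt /delta => h; rewrite leNgt; apply: contra h => hX.
  have pk : (6 * k%:R)^-1 * k%:R = 1 / 6 :> RR by field.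
  have p0 : 0 < (6 * k%:R)^-1 :> RR by rewrite invr_gt0; lra.
  by move: (_^-1 : RR) pk p0 => p pk p0; nra.
(* With at most [k - 1] clusters the right side would be at most
   [(k - 1) * (1 + 1 / (3 * k)) + 1 / 2], which equals [k - 1 / 6 - 1 / (3 * k)]. The summand
   [1 / 2] leaves room for a light head that gets dropped. *)
have count (t : seq {set 'I_N}) : {in t, forall S, mass m S <= 1 + (3 * k%:R)^-1} ->
    k%:R - 1 / 6 <= 1 / 2 + \sum_(S <- t) mass m S -> (k <= size t)%N.
  move=> mt tott; rewrite leqNgt; apply/negP => tk.
  have sz : (size t)%:R <= k%:R - 1 :> RR by rewrite lerBrDr natr1 ler_nat.
  have : \sum_(S <- t) mass m S <= (size t)%:R * (1 + (3 * k%:R)^-1).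
    rewrite big_seq mulr_natl; apply: le_trans (ler_sum _ mt) _.
    by rewrite -big_seq big_const_seq count_predT iter_addr addr0.
  have : (k%:R - 1) * (1 + (3 * k%:R)^-1) = k%:R - 1 + 1 / 3 - (3 * k%:R)^-1 :> RR by field.
  have p1 : 0 < (3 * k%:R)^-1 :> RR by rewrite invr_gt0; lra.
  by nra.
case: s' => [|H t] in sep' mass' big' tot tot' *.
  by move: tot; rewrite big_nil; lra.
have [hH|hH] := lerP (1 / 2) (mass m H).
  exists (H :: t); split=> //.
    apply: count => //; lra.
  by move=> S; rewrite inE => /orP[/eqP ->|/big'].
exists t; split=> //.
  apply: count => [S St|]; first by apply: mass'; rewrite inE St orbT.
  by move: tot; rewrite big_cons; lra.
by have /= /andP[] := sep'.
Qed.

Variable e : RR.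
Hypothesis e_gt0 : 0 < e.

(** A tent function: 1 on [T], and 0 at distance [e / 2] or more from it. The default [0] of the
    maximum does the truncation. *)
Definition cutoff (T : {set 'I_N}) (u : 'I_N) : RR :=
  \big[Num.max/0]_(v in T) (1 - 2 / e * d u v).

Lemma cutoff_ge0 T u : 0 <= cutoff T u.
Proof. exact: bigmax_ge_id. Qed.

Lemma cutoff_le1 T u : cutoff T u <= 1.
Proof.
apply: bigmax_le => // v _.
by rewrite lerBlDr lerDl mulr_ge0 ?pdist_ge0 ?divr_ge0 ?ltW.
Qed.

Lemma cutoff_ge1 (T : {set 'I_N}) u : u \in T -> 1 <= cutoff T u.
Proof.
by move=> uT; apply: (bigmax_sup u) => //; rewrite pdistxx mulr0 subr0.
Qed.

Lemma cutoff_near T u : 0 < cutoff T u -> exists2 v, v \in T & d u v < e / 2.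
Proof.
case: (pickP (fun v => (v \in T) && (d u v < e / 2))) => [v /andP[vT dv] _|far].
  by exists v.
rewrite ltNge => /negP[]; apply: bigmax_le => // v vT.
have := far v; rewrite vT /= => /negbT; rewrite -leNgt subr_le0 => h.
by rewrite mulrC mulrA ler_pdivlMr // mul1r; lra.
Qed.

Lemma cutoff_lipschitz T u v : `|cutoff T u - cutoff T v| <= 2 / e * d u v.
Proof.
have c0 : 0 <= 2 / e by rewrite divr_ge0 ?ltW.
have half x y : cutoff T x <= cutoff T y + 2 / e * d x y.
  apply: bigmax_le => [|z zT].
    by rewrite addr_ge0 ?cutoff_ge0 // mulr_ge0 // pdist_ge0.
  rewrite -lerBlDr; apply: (bigmax_sup z) => //.
  have := pdist_triangle (unitv (F y)) (unitv (F x)) (unitv (F z)).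
  rewrite (pdistC (unitv (F y)) (unitv (F x))) => tr.
  have := ler_wpM2l c0 tr; rewrite mulrDr.
  by move: (2 / e * _) (2 / e * _) (2 / e * _) => a b c; lra.
rewrite ler_norml; apply/andP; split; last by rewrite lerBlDl half.
by have := half v u; rewrite (pdistC (unitv (F v))); lra.
Qed.

(** A Leibniz rule: the vector is [cutoff T u *: (F u + F v)] plus
    [(cutoff T v - cutoff T u) *: F v]. The Lipschitz constant [2 / e] and the factor 2 of the
    radial projection combine to [4 / e]. *)
Lemma cutoff_sum_le T u v :
  sqnorm (cutoff T u *: F u + cutoff T v *: F v) <=
  (1 + 4 / e) ^+ 2 * sqnorm (F u + F v).
Proof.
have c0 : 0 <= 4 / e by rewrite divr_ge0 ?ltW.
rewrite -!sqr_enorm -exprMn ler_pXn2r ?nnegrE ?mulr_ge0 ?addr_ge0 ?enorm_ge0 //.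
have -> : cutoff T u *: F u + cutoff T v *: F v =
    cutoff T u *: (F u + F v) + (cutoff T v - cutoff T u) *: F v.
  by rewrite scalerDr scalerBl addrACA subrr addr0.
apply: le_trans (enorm_triangle _ _) _; rewrite mulrDl mul1r.
apply: lerD.
  rewrite enormZ ger0_norm ?cutoff_ge0 // -[leRHS]mul1r ler_wpM2r ?enorm_ge0 //.
  exact: cutoff_le1.
rewrite enormZ distrC; apply: le_trans (ler_wpM2r (enorm_ge0 _) (cutoff_lipschitz _ _ _)) _.
have e20 : 0 <= 2 / e by rewrite divr_ge0 ?ltW.
rewrite -[leLHS]mulrA.
apply: le_trans (ler_wpM2l e20 (pdist_unitv_mul (F u) (F v))) _.
by rewrite mulrA le_eqVlt; apply/orP; left; apply/eqP; field; rewrite gt_eqF.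
Qed.

(** The coordinates of the localized map have total squared norm at least [1 / 2], so one of them
    has an energy ratio of at most twice the total energy, and dual Cheeger applies to it. Staying
    within [e / 2] of [T] keeps the pairs of different clusters disjoint. *)
Lemma localized_pair (T : {set 'I_N}) : 1 / 2 <= mass m T ->
  exists AB : {set 'I_N} * {set 'I_N}, [/\ [disjoint AB.1 & AB.2], AB.1 :|: AB.2 != set0,
    {in AB.1 :|: AB.2, forall u, exists2 v, v \in T & d u v < e / 2}
  & 1 - phibar w AB.1 AB.2 <=
    Num.sqrt (2 * ((1 + 4 / e) ^+ 2 * \sum_u \sum_v w u v * sqnorm (F u + F v)))].
Proof.
move=> mT; pose psi j u := cutoff T u * F u 0 j.
set En := \sum_u _.
have En0 : 0 <= En.
  apply: sumr_ge0 => u _; apply: sumr_ge0 => v _.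
  by rewrite mulr_ge0 ?sqnorm_ge0 ?(w_ge0 w_graph).
have sum_en : \sum_j signless_energy w (psi j) <= (1 + 4 / e) ^+ 2 * En.
  rewrite exchange_big mulr_sumr; apply: ler_sum => u _ /=.
  rewrite exchange_big mulr_sumr; apply: ler_sum => v _ /=.
  rewrite -mulr_sumr mulrCA ler_wpM2l ?(w_ge0 w_graph) //.
  apply: le_trans (cutoff_sum_le T u v).
  by rewrite le_eqVlt; apply/orP; left; apply/eqP/eq_bigr => j _; rewrite !mxE.
have sum_norm : 1 / 2 <= \sum_j sqnorm_deg w (psi j).
  apply: le_trans mT _.
  rewrite exchange_big /mass [leRHS](bigID (mem T)) /= -[leLHS]addr0; apply: lerD.
    apply: ler_sum => u uT; rewrite -mulr_sumr ler_wpM2l ?(deg_ge0 w_graph) //.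
    apply: ler_sum => j _; rewrite /psi exprMn -[leLHS]mul1r ler_wpM2r ?sqr_ge0 //.
    by rewrite expr_ge1 ?cutoff_ge1 ?cutoff_ge0.
  apply: sumr_ge0 => u _; apply: sumr_ge0 => j _.
  by rewrite mulr_ge0 ?sqr_ge0 ?(deg_ge0 w_graph).
have [||||j _ [b0 ab]] := @exists_ratio_le _ _ (index_enum 'I_k)
    (fun j => signless_energy w (psi j)) (fun j => sqnorm_deg w (psi j))
    (2 * ((1 + 4 / e) ^+ 2 * En)).
- by move=> j _; apply: sqnorm_deg_ge0.
- by move=> j _ _; apply: signless_energy_ge0.
- apply: le_trans sum_en _.
  have := mulr_ge0 (sqr_ge0 (1 + 4 / e)) En0; move: (_ * En) => X X0; nra.
- by lra.
have [A [B [dAB nAB sAB phi]]] := dual_cheeger w_graph deg_gt0 b0.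
exists (A, B); split=> //=.
  move=> u /(subsetP sAB); rewrite inE => psi0; apply: cutoff_near.
  rewrite lt_def cutoff_ge0 andbT; apply: contra psi0 => /eqP z.
  by rewrite /psi z mul0r.
apply: le_trans phi _; apply: ler_wsqrtr.
by rewrite ler_pdivrMr.
Qed.

End Localization.

(** * Assembling the sub-bipartition and both inequalities *)

Lemma disjoint_sub_bipartition (N k : nat) (P : {ffun 'I_k -> {set 'I_N} * {set 'I_N}}) :
    (forall i, [disjoint (P i).1 & (P i).2]) ->
    (forall i, (P i).1 :|: (P i).2 != set0) ->
    (forall i j : 'I_k, (i < j)%N -> [disjoint (P i).1 :|: (P i).2 & (P j).1 :|: (P j).2]) ->
  sub_bipartition P.
Proof.
move=> d1 n0 d2; apply/andP; split; apply/forallP => i; first by rewrite d1 n0.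
apply/forallP => j; apply/implyP => ij.
have {}d2 : [disjoint (P i).1 :|: (P i).2 & (P j).1 :|: (P j).2].
  have /orP[/d2//|/d2] : (i < j)%N || (j < i)%N by rewrite -neq_ltn.
  by rewrite disjoint_sym.
have dj (A B : {set 'I_N}) : A \subset (P i).1 :|: (P i).2 ->
    B \subset (P j).1 :|: (P j).2 -> [disjoint A & B].
  by move=> sA sB; apply: disjointWl sA _; apply: disjointWr sB _.
by rewrite !dj ?subsetUl ?subsetUr.
Qed.

Lemma hbar_ge (N : nat) (w : 'M[RR]_N) (k : nat) (F : 'I_N -> 'rV[RR]_k) (eta : RR) :
    weighted_graph w -> (forall u, 0 < deg w u) -> (0 < k)%N ->
    (forall x, \sum_u deg w u * dotp x (F u) ^+ 2 = sqnorm x) ->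
    \sum_u deg w u * sqnorm (F u) = k%:R ->
    \sum_u \sum_v w u v * sqnorm (F u + F v) <= 2 * k%:R * eta ->
  1 - hbar w k <= 770 * k%:R ^+ 3 * Num.sqrt eta.
Proof.
move=> w_graph deg_gt0 k_gt0 F_iso F_total F_energy.
have [|s [size_s mass_s sep_s]] := separated_clusters w_graph k_gt0 F_iso.
  by rewrite /mass -F_total; apply: eq_bigl => u; rewrite inE.
set q : RR := Num.sqrt k%:R in sep_s; set e := _^-1 in sep_s.
have k1 : 1 <= k%:R :> RR by rewrite ler1n.
have q2 : q ^+ 2 = k%:R by rewrite sqr_sqrtr // ler0n.
have q1 : 1 <= q by rewrite -(sqrtr1 RR) ler_wsqrtr.
have e_gt0 : 0 < e.
  by rewrite invr_gt0 mulr_gt0 ?mulr_gt0 ?exprn_gt0 //; lra.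
have [P PE] := fin_all_exists (fun i : 'I_k => localized_pair w_graph deg_gt0 e_gt0
  (mass_s _ (mem_nth set0 (leq_trans (ltn_ord i) size_s)))).
have sub_P : sub_bipartition (finfun P).
  apply: disjoint_sub_bipartition => [i|i|i j ij]; rewrite ?ffunE.
  - by have [] := PE i.
  - by have [] := PE i.
  have [_ _ near_i _] := PE i; have [_ _ near_j _] := PE j.
  (* A common vertex would put [x] and [y] at distance less than [e], although their clusters are
     more than [e] apart. *)
  rewrite disjoint_subset; apply/subsetP => u /near_i [x xi dx].
  apply/negP => /near_j [y yj dy].
  have /separatedP/(_ x y xi yj) : separated (fun u v => pdist (unitv (F u)) (unitv (F v)))
      e (nth set0 s i) (nth set0 s j).
    move/(pairwiseP set0): sep_s; apply => //; rewrite inE.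
      exact: leq_trans (ltn_ord i) size_s.
    exact: leq_trans (ltn_ord j) size_s.
  have := pdist_triangle (unitv (F x)) (unitv (F u)) (unitv (F y)).
  by rewrite (pdistC (unitv (F x)) (unitv (F u))); lra.
suff : 1 - 770 * k%:R ^+ 3 * Num.sqrt eta <= hbar w k by lra.
(* The lower bound must also hold for the default [1] of the minimum, which is settled first. *)
apply: (bigmax_sup (finfun P)) => //; apply: le_bigmin => [|i _].
  by rewrite lerBlDr lerDl !mulr_ge0 ?exprn_ge0 ?sqrtr_ge0.
rewrite ffunE; have [_ _ _] := PE i.
set En := \sum_u _ in F_energy *; set X := Num.sqrt (2 * _).
suff : X <= 770 * k%:R ^+ 3 * Num.sqrt eta by lra.
have -> : 770 * k%:R ^+ 3 * Num.sqrt eta = Num.sqrt ((770 * k%:R ^+ 3) ^+ 2 * eta).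
  by rewrite sqrtrM ?sqr_ge0 // sqrtr_sqr ger0_norm // mulr_ge0 // exprn_ge0.
apply: ler_wsqrtr.
(* Here [4 / e] is [384] times [k ^ (5/2)], and the leading 1 is absorbed. With the energy bound
   [2 * k * eta] the radicand becomes [4 * 385 ^+ 2 * k ^+ 6 * eta], whence the constant [770]. *)
have eE : 1 + 4 / e <= 385 * (q ^+ 2) ^+ 2 * q.
  rewrite /e invrK -q2.
  have : 1 <= (q ^+ 2) ^+ 2 * q.
    by rewrite mulr_ege1 // expr_ge1 // ?expr_ge1 // ?exprn_ge0; lra.
  by lra.
have En0 : 0 <= En.
  apply: sumr_ge0 => u _; apply: sumr_ge0 => v _.
  by rewrite mulr_ge0 ?sqnorm_ge0 ?(w_ge0 w_graph).
apply: (@le_trans _ _ (2 * ((385 * (q ^+ 2) ^+ 2 * q) ^+ 2 * En))).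
  rewrite ler_wpM2l // ler_wpM2r // ler_pXn2r ?nnegrE //.
    by rewrite addr_ge0 // divr_ge0 // ltW.
  by rewrite !mulr_ge0 ?exprn_ge0 //; lra.
apply: (@le_trans _ _ (2 * ((385 * (q ^+ 2) ^+ 2 * q) ^+ 2 * (2 * k%:R * eta)))).
  by rewrite ler_wpM2l // ler_wpM2l // sqr_ge0.
by rewrite le_eqVlt; apply/orP; left; apply/eqP; rewrite -q2; ring.
Qed.

Theorem theorem1p2 :
  exists C : RR, 0 < C /\
  forall (N : nat) (w : 'M[RR]_N),
    weighted_graph w ->
    (forall u, 0 < deg w u) ->
    forall lam : seq RR,
      sorted <=%R lam ->
      char_poly (normLap w) = \prod_(x <- lam) ('X - x%:P) ->
      forall k : nat, (1 <= k <= N)%N ->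
        (2 - lam`_(N - k)) / 2 <= 1 - hbar w k /\
        1 - hbar w k <= C * (k%:R) ^+ 3 * Num.sqrt (2 - lam`_(N - k)).
Proof.
exists 770; split=> // N w w_graph deg_gt0 lam srt chL k /andP[k1 kN].
have szlam : size lam = N.
  by apply: succn_inj; rewrite -(size_prod_XsubC lam id) -chL size_char_poly.
have [f [f_orth f_eigen f_span]] := laplacian_eigenbasis w_graph deg_gt0 chL.
have topP (i : 'I_k) : (N - k + i < N)%N by have := ltn_ord i; lia.
pose top i := Ordinal (topP i).
split.
  suff : hbar w k <= lam`_(N - k) / 2 by lra.
  apply: bigmax_le => [|P subP].
    have := eigenvalue_ge0 w_graph f_orth f_eigen f_span (top (Ordinal k1)).
    by rewrite /= addn0; lra.
  have [|i] := sub_bipartition_phibar_le w_graph deg_gt0 f_eigen f_span szlam srt _ subP.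
    by rewrite k1.
  by apply: le_trans; apply: bigmin_le.
have top_inj (i j : 'I_k) : (top i == top j) = (i == j).
  by apply/eqP/eqP => [/(congr1 val) /= h|->//]; apply: val_inj => /=; lia.
(* The coordinates of [F] are the top [k] eigenfunctions: orthonormality gives isotropy and total
   mass [k], and each coordinate has energy at most [2 * (2 - lambda)]. *)
pose F u : 'rV[RR]_k := \row_i f (top i) u.
apply: (@hbar_ge _ _ _ F) => //.
- move=> x; transitivity (\sum_i \sum_j x 0 i * x 0 j * dot_deg w (f (top i)) (f (top j))).
    rewrite (eq_bigr (fun u => \sum_i \sum_j x 0 i * x 0 j *
       (deg w u * (f (top i) u * f (top j) u)))).
      rewrite exchange_big; apply: eq_bigr => i _ /=.
      by rewrite exchange_big; apply: eq_bigr => j _ /=; rewrite -mulr_sumr.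
    move=> u _; rewrite expr2 {1}/dotp mulr_suml mulr_sumr; apply: eq_bigr => i _.
    rewrite /dotp !mulr_sumr; apply: eq_bigr => j _; rewrite !mxE; ring.
  apply: eq_bigr => i _; rewrite (bigD1 i) //= f_orth eqxx mulr1 big1 ?addr0 //.
  by move=> j ji; rewrite f_orth top_inj eq_sym (negPf ji) mulr0.
- rewrite (eq_bigr (fun u => \sum_i deg w u * (f (top i) u * f (top i) u))).
    rewrite exchange_big (eq_bigr (fun=> 1)) => [|i _].
      by rewrite sumr_const card_ord.
    by have := f_orth (top i) (top i); rewrite eqxx.
  by move=> u _; rewrite /sqnorm mulr_sumr; apply: eq_bigr => i _; rewrite mxE expr2.
- have -> : \sum_u \sum_v w u v * sqnorm (F u + F v) =
      \sum_i signless_energy w (f (top i)).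
    rewrite [RHS]exchange_big; apply: eq_bigr => u _ /=.
    rewrite [RHS]exchange_big; apply: eq_bigr => v _ /=.
    by rewrite -mulr_sumr; congr (_ * _); apply: eq_bigr => i _; rewrite !mxE.
  apply: (@le_trans _ _ (\sum_(i < k) 2 * (2 - lam`_(N - k)))).
    apply: ler_sum => i _.
    rewrite (signless_energy_eigen w_graph f_orth f_eigen f_span) ler_wpM2l //.
    by rewrite lerD2l lerN2 sorted_nth_le // szlam topP andbT leq_addr.
  by rewrite sumr_const card_ord -[leLHS]mulr_natr [leRHS]mulrAC.
Qed.
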